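(* Let $\nu>0$ and $\beta\in(2,\tfrac52]$. Let $(x_n)_{n\ge1}$ be a real sequence such that $x_n\ge 0$ for all $n\ge1$ and $\sum_{n=1}^\infty x_n^2<\infty$. Then there exists a unique solution $X=(X_n)_{n\ge1}$ on $[0,\infty)$ of the viscous dyadic problem $$\dot X_n=-\nu\lambda_n^2X_n+\lambda_{n-1}^\beta X_{n-1}^2-\lambda_n^\beta X_nX_{n+1},\qquad X_n(0)=x_n,\qquad n\ge1,\ t\ge0,$$ and this solution is smooth, that is, $$\sup_{n\ge1}\bigl(\lambda_n^\gamma X_n(t)\bigr)<\infty\qquad\text{for all }\gamma>0\text{ and all }t>0.$$
   Context: Notation: $\lambda=2$, $\lambda_n=\lambda^n=2^n$ for $n\ge1$, and $\lambda_0=0$ (so the term $\lambda_{0}^\beta X_0^2$ in the equation for $n=1$ is zero). A solution (weak solution) is a sequence $X=(X_n)_{n\ge1}$ of real-valued functions, each $X_n$ continuously differentiable in time, such that the equations and the initial conditions hold for every $n\ge1$. *)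

(* Defs.v *)
(* Stdlib real numbers with Coquelicot. *)
From Stdlib Require Import Reals.
From Coquelicot Require Import Coquelicot.
Open Scope R_scope.

(* Stdlib's [Rpower] satisfies [Rpower 0 s = 1] (because [ln 0 = 0] there), which
   is wrong for [lambda 0 = 0]; here [rpow 0 s = 0], the usual value of 0^s for
   [s > 0].  Only non-negative bases and positive exponents are used below. *)
Definition rpow (a s : R) : R := if Rlt_dec 0 a then Rpower a s else 0.

Definition lambda (n : nat) : R :=
  match n with
  | O => 0
  | S _ => 2 ^ n
  end.

Definition nonneg_time (t : R) : Prop := 0 <= t.

(* A function on [0, infinity) is encoded by a function on R of which only the
   values at t >= 0 matter; [D_in] and [continue_in] are relative to the
   half-line, hence one-sided at t = 0. *)
Definition C1_derivative (f df : R -> R) : Prop :=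
  forall t : R, 0 <= t ->
    D_in f df nonneg_time t /\ continue_in df nonneg_time t.

(* Sequences are indexed by n >= 1; the entries [X 0] and [x 0] are junk, the
   former occurring only in the term [rpow (lambda 0) beta * (X 0 t)^2 = 0]. *)
Definition weak_solution (nu beta : R) (x : nat -> R) (X : nat -> R -> R) : Prop :=
  forall n : nat, (1 <= n)%nat ->
    X n 0 = x n /\
    exists dX : R -> R,
      C1_derivative (X n) dX /\
      forall t : R, 0 <= t ->
        dX t = - nu * (lambda n) ^ 2 * X n t
               + rpow (lambda (n - 1)) beta * (X (n - 1)%nat t) ^ 2
               - rpow (lambda n) beta * X n t * X (n + 1)%nat t.

Definition smooth (X : nat -> R -> R) : Prop :=
  forall gamma t : R, 0 < gamma -> 0 < t ->
    Rbar_lt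
      (Lub_Rbar (fun y : R => exists n : nat,
                   (1 <= n)%nat /\ y = rpow (lambda n) gamma * X n t))
      p_infty.

(* Main.v *)
Require Import Defs.
From Stdlib Require Import Reals Lra Lia List Classical IndefiniteDescription.
From Coquelicot Require Import Coquelicot.
Open Scope R_scope.

(** Write [c n = lambda n ^ beta] for the transfer rate out of shell [n].

    A priori facts.  A solution with non-negative data stays non-negative, because
    [X n] solves a linear equation with a non-negative source.  In the balance of
    [X 1 ^ 2 + ... + X N ^ 2] the transfers telescope, and what is left is the viscous
    dissipation and a flux through shell [N] that has the good sign
    ([energy_balance]).

    Uniqueness and existence.  For the difference of two solutions, the sum of the
    [2 ^ - n (X n - Y n) ^ 2], [n <= N], has a balance in which the transfers also
    telescope ([weighted_balance]).  The flux through shell [N] is of order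
    [2 ^ - N c N (X N ^ 2 + Y N ^ 2)] and is paid by the dissipation of the two
    energies, at a price of order [2 ^ ((beta - 3) N)] ([comparison]).  As
    [beta < 3], letting [N] grow gives uniqueness.  The estimate uses the first [N]
    equations only, so it applies to Galerkin approximations as well and shows that
    they form a Cauchy sequence; their limit is the solution.  The approximations
    themselves come from Picard iteration for a clamped system
    ([galerkin_solution]).

    Smoothness.  By the energy inequality, arbitrarily small positive times carry
    a finite enstrophy ([finite_enstrophy_time]), hence a bound on [lambda n X n].
    The main point is that a bound on [lambda n ^ a X n], with an exponent [a] above the
    critical value [beta - 2], propagates in time.  This cannot be seen on one shell:
    when [lambda n ^ a X n] is maximal, it is kept from growing only if the next
    shell is filled enough to drain it.  So one shows instead that the pairs of
    rescaled neighbours [(x, y)] remain in a region of the unit square which lies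
    above a quartic curve and below a line ([normalized_region]).  The quartic forces
    [y] to be large when [x] is close to 1.  The line keeps [y] from saturating, so that
    [y] can still be filled in time.  The power 4 matches the ratio of the viscous
    rates of neighbouring shells, so that viscosity does not push [(x, y)] across the
    quartic.  Finally, a bound with a supercritical exponent improves itself by a
    fixed amount, again and again ([regularity_gain]). *)

(** * Calculus on a half-line *)

Lemma continuous_eps (f : R -> R) (x : R) :
  continuous f x ->
  forall eps, 0 < eps ->
  exists d, 0 < d /\ forall y, Rabs (y - x) < d -> Rabs (f y - f x) < eps.
Proof.
  intros Hf eps Heps.
  assert (H := proj1 (filterlim_locally f (f x)) Hf (mkposreal eps Heps)).
  destruct H as [d Hd].
  exists d; split; [apply cond_pos|].
  intros y Hy; exact (Hd y Hy).
Qed.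

Lemma continuous_of_eps (f : R -> R) (x : R) :
  (forall eps, 0 < eps ->
   exists d, 0 < d /\ forall y, Rabs (y - x) < d -> Rabs (f y - f x) < eps) ->
  continuous f x.
Proof.
  intros H. apply filterlim_locally. intros eps.
  destruct (H eps (cond_pos eps)) as [d [Hd Hy]].
  exists (mkposreal d Hd). intros y Hyx. apply Hy, Hyx.
Qed.

Lemma derive_continuous (f : R -> R) (x l : R) :
  is_derive f x l -> continuous f x.
Proof.
  intros H. apply (ex_derive_continuous (K := R_AbsRing) (V := R_NormedModule) f x).
  exists l. exact H.
Qed.

Lemma continuous_Rplus (f g : R -> R) (x : R) :
  continuous f x -> continuous g x -> continuous (fun y => f y + g y) x.
Proof. exact (continuous_plus f g x). Qed.

Lemma continuous_Rminus (f g : R -> R) (x : R) :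
  continuous f x -> continuous g x -> continuous (fun y => f y - g y) x.
Proof. exact (continuous_minus f g x). Qed.

Lemma continuous_Ropp (f : R -> R) (x : R) :
  continuous f x -> continuous (fun y => - f y) x.
Proof. exact (continuous_opp f x). Qed.

Lemma continuous_Rmult (f g : R -> R) (x : R) :
  continuous f x -> continuous g x -> continuous (fun y => f y * g y) x.
Proof. exact (continuous_mult f g x). Qed.

Lemma continuous_Rpow (f : R -> R) (k : nat) (x : R) :
  continuous f x -> continuous (fun y => f y ^ k) x.
Proof.
  intros Hf. induction k as [|k IH]; simpl.
  - apply continuous_const.
  - apply continuous_Rmult; assumption.
Qed.

Lemma continuous_exp_linear (M x : R) : continuous (fun y => exp (M * y)) x.
Proof. apply (derive_continuous _ _ (M * exp (M * x))). auto_derive; [exact I|ring]. Qed.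

Ltac continuity :=
  solve [repeat first
    [ assumption
    | match goal with
      | |- continuous (fun y => _ + _) _ => apply continuous_Rplus
      | |- continuous (fun y => _ - _) _ => apply continuous_Rminus
      | |- continuous (fun y => - _) _ => apply continuous_Ropp
      | |- continuous (fun y => exp (_ * y)) _ => apply continuous_exp_linear
      | |- continuous (fun y => _ * _) _ => apply continuous_Rmult
      | |- continuous (fun y => _ ^ _) _ => apply continuous_Rpow
      | |- continuous (fun y => y) _ => apply continuous_id
      | |- continuous (fun y => ?c) _ => apply continuous_const
      end
    | solve [auto] ]].

Lemma is_derive_eq (f : R -> R) (x l l' : R) :
  is_derive f x l' -> l' = l -> is_derive f x l.
Proof. intros H <-. exact H. Qed.

Lemma is_derive_Rplus (f g : R -> R) (x a b : R) :
  is_derive f x a -> is_derive g x b -> is_derive (fun y => f y + g y) x (a + b).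
Proof. exact (is_derive_plus f g x a b). Qed.

Lemma is_derive_Rminus (f g : R -> R) (x a b : R) :
  is_derive f x a -> is_derive g x b -> is_derive (fun y => f y - g y) x (a - b).
Proof. exact (is_derive_minus f g x a b). Qed.

Lemma is_derive_Ropp (f : R -> R) (x a : R) :
  is_derive f x a -> is_derive (fun y => - f y) x (- a).
Proof. exact (is_derive_opp f x a). Qed.

Lemma is_derive_Rmult (f g : R -> R) (x a b : R) :
  is_derive f x a -> is_derive g x b ->
  is_derive (fun y => f y * g y) x (a * g x + f x * b).
Proof.
  intros Ha Hb. apply (is_derive_mult f g x a b Ha Hb).
  intros n m. apply Rmult_comm.
Qed.

Lemma is_derive_sq (f : R -> R) (x a : R) :
  is_derive f x a -> is_derive (fun y => f y ^ 2) x (2 * f x * a).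
Proof.
  intros H. apply (is_derive_eq _ _ _ _ (is_derive_pow f 2 x a H)). simpl. ring.
Qed.

Lemma is_derive_fourth (f : R -> R) (x a : R) :
  is_derive f x a -> is_derive (fun y => f y ^ 4) x (4 * f x ^ 3 * a).
Proof.
  intros H. apply (is_derive_eq _ _ _ _ (is_derive_pow f 4 x a H)). simpl. ring.
Qed.

Lemma is_derive_Rconst (c x : R) : is_derive (fun _ => c) x 0.
Proof. exact (is_derive_const c x). Qed.

Lemma is_derive_Rid (x : R) : is_derive (fun y => y) x 1.
Proof. exact (is_derive_id x). Qed.

Lemma is_derive_exp_linear (M x : R) :
  is_derive (fun y => exp (M * y)) x (M * exp (M * x)).
Proof. auto_derive; [exact I|ring]. Qed.

Ltac derivative :=
  repeat first
    [ eassumption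
    | match goal with
      | |- is_derive (fun y => _ + _) _ _ => apply is_derive_Rplus
      | |- is_derive (fun y => _ - _) _ _ => apply is_derive_Rminus
      | |- is_derive (fun y => - _) _ _ => apply is_derive_Ropp
      | |- is_derive (fun y => exp (_ * y)) _ _ => apply is_derive_exp_linear
      | |- is_derive (fun y => _ * _) _ _ => apply is_derive_Rmult
      | |- is_derive (fun y => _ ^ 2) _ _ => apply is_derive_sq
      | |- is_derive (fun y => _ ^ 4) _ _ => apply is_derive_fourth
      | |- is_derive (fun y => y) _ _ => apply is_derive_Rid
      | |- is_derive (fun y => ?c) _ _ => apply is_derive_Rconst
      end ].

Lemma Rmax_lipschitz (x y : R) : Rabs (Rmax 0 y - Rmax 0 x) <= Rabs (y - x).
Proof.
  unfold Rmax, Rabs.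
  destruct (Rle_dec 0 y), (Rle_dec 0 x), (Rcase_abs (y - x));
    try match goal with |- context [Rcase_abs ?a] => destruct (Rcase_abs a) end; lra.
Qed.

Lemma positive_near (f : R -> R) (x : R) :
  continuous f x -> 0 < f x ->
  exists d, 0 < d /\ forall y, Rabs (y - x) < d -> 0 < f y.
Proof.
  intros Hc Hf.
  destruct (continuous_eps f x Hc (f x) Hf) as [d [Hd H]].
  exists d; split; [exact Hd|].
  intros y Hy. specialize (H y Hy). apply Rabs_def2 in H. lra.
Qed.

Lemma nonincreasing (f df : R -> R) (s t : R) :
  s <= t ->
  (forall r, continuous f r) ->
  (forall r, s < r < t -> is_derive f r (df r)) ->
  (forall r, s < r < t -> df r <= 0) ->
  f t <= f s.
Proof.
  intros [Hst|<-] Hc Hd Hn; [|lra].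
  destruct (MVT_gen f s t (fun r => Rmin (df r) 0)) as [c [_ H]].
  - rewrite Rmin_left, Rmax_right by lra. intros r Hr.
    rewrite Rmin_left by (apply Hn; exact Hr). apply Hd; exact Hr.
  - intros r _. apply continuity_pt_filterlim, Hc.
  - assert (Hm := Rmin_r (df c) 0). simpl in H. nra.
Qed.

(** Multiplying by an exponential turns the hypothesis into monotonicity on
    the time interval that follows the last instant at which [f >= 0]. *)
Lemma lower_barrier (f df : R -> R) (M s t : R) :
  s <= t ->
  (forall r, continuous f r) ->
  (forall r, s < r < t -> is_derive f r (df r)) ->
  (forall r, s < r < t -> f r < 0 -> M * f r <= df r) ->
  0 <= f s -> 0 <= f t.
Proof.
  intros Hst Hc Hd HM Hs.
  destruct (Rle_or_lt 0 (f t)) as [H0|H0]; [exact H0|exfalso].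
  set (E := fun r => s <= r <= t /\ 0 <= f r).
  destruct (completeness E) as [m [Hub Hlub]].
  { exists t. intros r [[_ Hr] _]; exact Hr. }
  { exists s. split; [lra|exact Hs]. }
  assert (Hsm : s <= m) by (apply Hub; split; [lra|exact Hs]).
  assert (Hmt : m <= t) by (apply Hlub; intros r [[_ Hr] _]; exact Hr).
  assert (Hfm : 0 <= f m).
  { destruct (Rle_or_lt 0 (f m)) as [H|H]; [exact H|exfalso].
    destruct (positive_near (fun r => - f r) m) as [d [Hd0 Hnear]].
    { continuity. }
    { lra. }
    assert (m <= m - d); [|lra].
    apply Hlub. intros r [Hr Hfr].
    destruct (Rle_or_lt r (m - d)) as [Hle|Hlt]; [exact Hle|exfalso].
    assert (r <= m) by (apply Hub; split; assumption).
    assert (0 < - f r); [|lra].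
    apply Hnear. apply Rabs_def1; lra. }
  assert (Hneg : forall r, m < r < t -> f r < 0).
  { intros r Hr. destruct (Rlt_or_le (f r) 0) as [H|H]; [exact H|exfalso].
    assert (r <= m); [|lra]. apply Hub. split; [lra|exact H]. }
  assert (Hfin : - f t * exp (- M * t) <= - f m * exp (- M * m)).
  { apply (nonincreasing (fun r => - f r * exp (- M * r))
             (fun r => - (df r - M * f r) * exp (- M * r))); [exact Hmt| | |].
    - intros r. continuity.
    - intros r Hr.
      assert (H := Hd r ltac:(lra)).
      eapply is_derive_eq; [derivative|cbv beta; ring].
    - intros r Hr. assert (H := HM r ltac:(lra) (Hneg r Hr)).
      assert (He := exp_pos (- M * r)). nra. }
  assert (He := exp_pos (- M * t)). assert (He' := exp_pos (- M * m)). nra.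
Qed.

Lemma derive_pos_left (f : R -> R) (t l : R) :
  is_derive f t l -> 0 < l -> f t = 0 ->
  exists d, 0 < d /\ forall r, t - d < r < t -> f r < 0.
Proof.
  intros Hd Hl H0. apply is_derive_Reals in Hd.
  destruct (Hd l Hl) as [d Hd'].
  exists d; split; [apply cond_pos|].
  intros r Hr.
  assert (H := Hd' (r - t) ltac:(lra) ltac:(rewrite Rabs_left; lra)).
  replace (t + (r - t)) with r in H by ring. rewrite H0 in H.
  apply Rabs_def2 in H.
  assert (Hq : 0 < (f r - 0) / (r - t)) by lra.
  assert (Hm : f r = (f r - 0) / (r - t) * (r - t)) by (field; lra).
  rewrite Hm. nra.
Qed.

(** At the first instant when one of the functions vanishes they are all still
    non-negative, and the vanishing one comes from positive values, which is
    incompatible with a positive derivative. *)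
Lemma first_exit (l : list (R -> R)) (s : R) :
  (forall f r, In f l -> continuous f r) ->
  (forall f, In f l -> 0 < f s) ->
  (forall f t, In f l -> s < t -> f t = 0 ->
     (forall g, In g l -> 0 <= g t) ->
     exists d, is_derive f t d /\ 0 < d) ->
  forall f t, In f l -> s <= t -> 0 < f t.
Proof.
  intros Hc Hs Hd.
  assert (Hnear : forall t, (forall f, In f l -> 0 < f t) ->
            exists d, 0 < d /\
            forall f r, In f l -> Rabs (r - t) < d -> 0 < f r).
  { clear Hs Hd. intros t. induction l as [|f l IH]; intros Hp.
    - exists 1; split; [lra|]. intros f r [].
    - destruct IH as [d1 [Hd1 H1]].
      { intros g r Hg; apply Hc; right; exact Hg. }
      { intros g Hg; apply Hp; right; exact Hg. }
      destruct (positive_near f t) as [d2 [Hd2 H2]].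
      { apply Hc; left; reflexivity. }
      { apply Hp; left; reflexivity. }
      exists (Rmin d1 d2); split; [apply Rmin_pos; assumption|].
      assert (Hm1 := Rmin_l d1 d2). assert (Hm2 := Rmin_r d1 d2).
      intros g r [<-|Hg] Hr; [apply H2; lra|apply (H1 g r Hg); lra]. }
  intros f0 t0 Hf0 Ht0.
  set (E := fun t => s <= t <= t0 /\
              forall r, s <= r <= t -> forall f, In f l -> 0 < f r).
  destruct (completeness E) as [m [Hub Hlub]].
  { exists t0. intros r [[_ Hr] _]; exact Hr. }
  { exists s. split; [lra|]. intros r Hr. replace r with s by lra. exact Hs. }
  assert (Hsm : s <= m).
  { apply Hub. split; [lra|]. intros r Hr. replace r with s by lra. exact Hs. }
  assert (Hmt : m <= t0) by (apply Hlub; intros r [[_ Hr] _]; exact Hr).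
  assert (Hbelow : forall r, s <= r < m -> forall f, In f l -> 0 < f r).
  { intros r Hr f Hf.
    destruct (classic (exists t, E t /\ r <= t)) as [[t [[_ Ht] Hrt]]|Hno].
    - apply (Ht r); [lra|exact Hf].
    - exfalso. assert (m <= r); [|lra]. apply Hlub. intros t Ht.
      destruct (Rle_or_lt t r) as [H|H]; [exact H|exfalso].
      apply Hno. exists t. split; [exact Ht|lra]. }
  assert (Hm : forall f, In f l -> 0 < f m).
  { destruct Hsm as [Hsm|<-]; [|exact Hs].
    assert (Hge : forall f, In f l -> 0 <= f m).
    { intros f Hf. destruct (Rle_or_lt 0 (f m)) as [H|H]; [exact H|exfalso].
      destruct (positive_near (fun r => - f r) m) as [d [Hd0 Hn]].
      { continuity. }
      { lra. }
      set (r := Rmax s (m - d / 2)).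
      assert (Hr : s <= r < m /\ m - d < r).
      { unfold r, Rmax. destruct (Rle_dec s (m - d / 2)); lra. }
      assert (0 < - f r) by (apply Hn, Rabs_def1; lra).
      assert (0 < f r) by (apply Hbelow; [lra|exact Hf]). lra. }
    intros f Hf. destruct (Hge f Hf) as [H|H]; [exact H|exfalso].
    destruct (Hd f m Hf Hsm (eq_sym H) Hge) as [d [Hder Hpos]].
    destruct (derive_pos_left f m d Hder Hpos (eq_sym H)) as [e [He Hn]].
    set (r := Rmax s (m - e / 2)).
    assert (Hr : s <= r < m /\ m - e < r).
    { unfold r, Rmax. destruct (Rle_dec s (m - e / 2)); lra. }
    assert (f r < 0) by (apply Hn; lra).
    assert (0 < f r) by (apply Hbelow; [lra|exact Hf]). lra. }
  destruct Hmt as [Hmt|<-]; [exfalso|apply Hm; exact Hf0].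
  destruct (Hnear m Hm) as [d [Hd0 Hn]].
  set (t := Rmin t0 (m + d / 2)).
  assert (Ht : m < t <= t0 /\ t < m + d).
  { unfold t, Rmin. destruct (Rle_dec t0 (m + d / 2)); lra. }
  assert (t <= m); [|lra].
  apply Hub. split; [lra|]. intros r Hr f Hf.
  destruct (Rlt_or_le r m) as [H|H].
  - apply Hbelow; [lra|exact Hf].
  - apply (Hn f r Hf), Rabs_def1; lra.
Qed.

(** * The shell model *)

(** The powers [lambda n ^ s], written so as to be positive for every [n], also
    for [n = 0], where [lambda n = 0]. *)
Definition pw (s : R) (n : nat) : R := Rpower 2 (s * INR n).

Definition coef (beta : R) (n : nat) : R := rpow (lambda n) beta.

Definition field (nu beta : R) (u : nat -> R) (n : nat) : R :=
  - nu * lambda n ^ 2 * u n + coef beta (n - 1) * u (n - 1)%nat ^ 2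
  - coef beta n * u n * u (n + 1)%nat.

Lemma pw_pos (s : R) (n : nat) : 0 < pw s n.
Proof. apply exp_pos. Qed.

Lemma pw_plus (s t : R) (n : nat) : pw (s + t) n = pw s n * pw t n.
Proof. unfold pw. rewrite <- Rpower_plus. f_equal. ring. Qed.

Lemma pw_S (s : R) (n : nat) : pw s (S n) = pw s n * Rpower 2 s.
Proof. unfold pw. rewrite <- Rpower_plus, S_INR. f_equal. ring. Qed.

Lemma pw_pow (s : R) (n : nat) : pw s n = Rpower 2 s ^ n.
Proof.
  induction n as [|n IH]; simpl.
  - unfold pw. simpl. rewrite Rmult_0_r. apply Rpower_O. lra.
  - rewrite pw_S, IH. ring.
Qed.

Lemma pw_le (s t : R) (n : nat) : s <= t -> pw s n <= pw t n.
Proof.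
  intros H. unfold pw. apply Rle_Rpower; [lra|].
  apply Rmult_le_compat_r; [apply pos_INR|exact H].
Qed.

Lemma lambda_pw (n : nat) : (1 <= n)%nat -> lambda n = pw 1 n.
Proof.
  destruct n as [|n]; [lia|intros _]. rewrite pw_pow, Rpower_1 by lra. reflexivity.
Qed.

Lemma lambda_sq_pw (n : nat) : (1 <= n)%nat -> lambda n ^ 2 = pw 2 n.
Proof.
  intros Hn. rewrite lambda_pw by exact Hn.
  replace (pw 2 n) with (pw (1 + 1) n) by (f_equal; ring). rewrite pw_plus. ring.
Qed.

Lemma rpow_lambda (s : R) (n : nat) : (1 <= n)%nat -> rpow (lambda n) s = pw s n.
Proof.
  intros Hn. unfold rpow. destruct n as [|n]; [lia|].
  assert (H : 0 < lambda (S n)) by (apply pow_lt; lra).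
  destruct (Rlt_dec 0 (lambda (S n))) as [_|Hno]; [|lra].
  unfold lambda. rewrite <- Rpower_pow by lra. rewrite Rpower_mult.
  unfold pw. f_equal. ring.
Qed.

Lemma coef_0 (beta : R) : coef beta 0 = 0.
Proof.
  unfold coef, rpow, lambda. destruct (Rlt_dec 0 0); [lra|reflexivity].
Qed.

Lemma coef_pw (beta : R) (n : nat) : (1 <= n)%nat -> coef beta n = pw beta n.
Proof. apply rpow_lambda. Qed.

Lemma coef_nonneg (beta : R) (n : nat) : 0 <= coef beta n.
Proof.
  destruct n as [|n]; [rewrite coef_0; lra|].
  rewrite coef_pw by lia. apply Rlt_le, pw_pos.
Qed.

Lemma lambda_sq_pos (n : nat) : (1 <= n)%nat -> 0 < lambda n ^ 2.
Proof. intros Hn. rewrite lambda_sq_pw by exact Hn. apply pw_pos. Qed.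

Lemma field_S (nu beta : R) (u : nat -> R) (n : nat) :
  field nu beta u (S n) =
  - nu * lambda (S n) ^ 2 * u (S n) + coef beta n * u n ^ 2
  - coef beta (S n) * u (S n) * u (S (S n)).
Proof.
  unfold field. replace (S n - 1)%nat with n by lia.
  replace (S n + 1)%nat with (S (S n)) by lia. reflexivity.
Qed.

(** Both the [N]-th Galerkin approximation and, for every [N], a solution are of
    this kind, so that one estimate gives the convergence of the former and
    the uniqueness of the latter.  Component 0 is normalised to zero, which gives
    shell 1 a harmless left neighbour. *)
Record flow (nu beta : R) (N : nat) (X : nat -> R -> R) : Prop := {
  flow_continuous : forall n t, continuous (X n) t;
  flow_nonneg : forall n t, 0 <= X n t;
  flow_zero : forall t, X 0%nat t = 0;
  flow_derive : forall n t, (1 <= n <= N)%nat -> 0 < t ->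
    is_derive (X n) t (field nu beta (fun m => X m t) n) }.

Lemma flow_le (nu beta : R) (M N : nat) (X : nat -> R -> R) :
  (M <= N)%nat -> flow nu beta N X -> flow nu beta M X.
Proof.
  intros H [H1 H2 H3 H4]. split; try assumption.
  intros n t Hn Ht. apply H4; [lia|exact Ht].
Qed.

(** * Energy *)

Fixpoint total (f : nat -> R) (N : nat) : R :=
  match N with O => 0 | S M => total f M + f (S M) end.

Lemma total_S (f : nat -> R) (N : nat) : total f (S N) = total f N + f (S N).
Proof. reflexivity. Qed.

Lemma total_le (f g : nat -> R) (N : nat) :
  (forall n, (1 <= n <= N)%nat -> f n <= g n) -> total f N <= total g N.
Proof.
  induction N as [|N IH]; intros H; simpl; [lra|].
  apply Rplus_le_compat; [apply IH; intros n Hn|]; apply H; lia.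
Qed.

Lemma total_ext (f g : nat -> R) (N : nat) :
  (forall n, (1 <= n <= N)%nat -> f n = g n) -> total f N = total g N.
Proof.
  intros H. apply Rle_antisym; apply total_le; intros n Hn; rewrite H by exact Hn; lra.
Qed.

Lemma total_zero (N : nat) : total (fun _ => 0) N = 0.
Proof. induction N as [|N IH]; simpl; [|rewrite IH]; ring. Qed.

Lemma total_nonneg (f : nat -> R) (N : nat) :
  (forall n, (1 <= n <= N)%nat -> 0 <= f n) -> 0 <= total f N.
Proof. intros H. rewrite <- (total_zero N). apply total_le, H. Qed.

Lemma total_mono (f : nat -> R) (M N : nat) :
  (M <= N)%nat -> (forall n, (1 <= n <= N)%nat -> 0 <= f n) -> total f M <= total f N.
Proof.
  intros HMN. induction HMN as [|N HMN IH]; intros H; [lra|]. simpl.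
  assert (0 <= f (S N)) by (apply H; lia).
  assert (total f M <= total f N); [apply IH; intros n Hn; apply H; lia|lra].
Qed.

Lemma term_le_total (f : nat -> R) (n N : nat) :
  (1 <= n <= N)%nat -> (forall n, (1 <= n <= N)%nat -> 0 <= f n) -> f n <= total f N.
Proof.
  intros Hn H. apply Rle_trans with (total f n).
  - destruct n as [|n]; [lia|]. simpl.
    assert (0 <= total f n); [apply total_nonneg; intros m Hm; apply H; lia|lra].
  - apply total_mono; [lia|exact H].
Qed.

Lemma total_continuous (f : nat -> R -> R) (N : nat) (t : R) :
  (forall n, continuous (f n) t) -> continuous (fun r => total (fun n => f n r) N) t.
Proof.
  intros H. induction N as [|N IH]; simpl; [apply continuous_const|].
  apply continuous_Rplus; [exact IH|apply H].
Qed.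

Lemma total_derive (f : nat -> R -> R) (g : nat -> R) (N : nat) (t : R) :
  (forall n, (1 <= n <= N)%nat -> is_derive (f n) t (g n)) ->
  is_derive (fun r => total (fun n => f n r) N) t (total g N).
Proof.
  induction N as [|N IH]; intros H; simpl; [apply (is_derive_const 0 t)|].
  apply is_derive_Rplus; [apply IH; intros n Hn|]; apply H; lia.
Qed.

Definition energy (X : nat -> R -> R) (N : nat) (t : R) : R :=
  total (fun n => X n t ^ 2) N.

Definition enstrophy (X : nat -> R -> R) (N : nat) (t : R) : R :=
  total (fun n => lambda n ^ 2 * X n t ^ 2) N.

(** The nonlinear transfers telescope: only the flux out of the last shell
    remains. *)
Lemma energy_balance (nu beta : R) (u : nat -> R) (N : nat) :
  total (fun n => 2 * u n * field nu beta u n) N =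
  - 2 * nu * total (fun n => lambda n ^ 2 * u n ^ 2) N
  - 2 * coef beta N * u N ^ 2 * u (S N).
Proof.
  induction N as [|N IH].
  - simpl total. rewrite coef_0. ring.
  - rewrite !total_S, IH, field_S. ring.
Qed.

Lemma energy_continuous (X : nat -> R -> R) (N : nat) (t : R) :
  (forall n t, continuous (X n) t) -> continuous (energy X N) t.
Proof.
  intros H. apply (total_continuous (fun n r => X n r ^ 2)). intros n. continuity.
Qed.

Lemma energy_derive (nu beta : R) (X : nat -> R -> R) (N : nat) (t : R) :
  flow nu beta N X -> 0 < t ->
  exists d, is_derive (energy X N) t d /\ d <= - 2 * nu * enstrophy X N t.
Proof.
  intros HX Ht.
  exists (total (fun n => 2 * X n t * field nu beta (fun m => X m t) n) N). split.
  - apply (total_derive (fun n r => X n r ^ 2)). intros n Hn.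
    assert (H := flow_derive _ _ _ _ HX n t Hn Ht).
    eapply is_derive_eq; [derivative|cbv beta; ring].
  - rewrite energy_balance. unfold enstrophy.
    assert (0 <= coef beta N * X N t ^ 2 * X (S N) t).
    { apply Rmult_le_pos; [apply Rmult_le_pos|].
      - apply coef_nonneg.
      - apply pow2_ge_0.
      - apply (flow_nonneg _ _ _ _ HX). }
    lra.
Qed.

Lemma enstrophy_nonneg (X : nat -> R -> R) (N : nat) (t : R) : 0 <= enstrophy X N t.
Proof. apply total_nonneg. intros n _. apply Rmult_le_pos; apply pow2_ge_0. Qed.

Lemma derive_exists (f : R -> R) (t : R) (P : R -> Prop) :
  (exists d, is_derive f t d /\ P d) -> is_derive f t (Derive f t) /\ P (Derive f t).
Proof.
  intros [d [H HP]]. rewrite (is_derive_unique _ _ _ H). split; assumption.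
Qed.

Lemma energy_dissipation (nu beta : R) (X : nat -> R -> R) (N : nat) (s t m : R) :
  0 < nu -> flow nu beta N X -> 0 <= s <= t ->
  (forall r, s < r < t -> m <= enstrophy X N r) ->
  energy X N t + 2 * nu * m * (t - s) <= energy X N s.
Proof.
  intros Hnu HX Hst Hm.
  assert (H : energy X N t + 2 * nu * m * (t - s) <= energy X N s + 2 * nu * m * (s - s)).
  { apply (nonincreasing (fun r => energy X N r + 2 * nu * m * (r - s))
             (fun r => Derive (energy X N) r + 2 * nu * m)); [lra| | |].
    - intros r.
      assert (continuous (energy X N) r)
        by apply energy_continuous, (flow_continuous _ _ _ _ HX).
      continuity.
    - intros r Hr. destruct (derive_exists _ _ _ (energy_derive _ _ X N r HX ltac:(lra))) as [Hd _].
      eapply is_derive_eq; [derivative|cbv beta; ring].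
    - intros r Hr. destruct (derive_exists _ _ _ (energy_derive _ _ X N r HX ltac:(lra))) as [_ Hd].
      assert (H := Hm r Hr). nra. }
  lra.
Qed.

Lemma energy_nonincreasing (nu beta : R) (X : nat -> R -> R) (N : nat) (s t : R) :
  0 < nu -> flow nu beta N X -> 0 <= s <= t -> energy X N t <= energy X N s.
Proof.
  intros Hnu HX Hst.
  assert (H := energy_dissipation nu beta X N s t 0 Hnu HX Hst
                 (fun r _ => enstrophy_nonneg X N r)). lra.
Qed.

(** * Comparison of two trajectories *)

(** Put [z = u - v] and [w = u + v].  The transfer terms of the equation for [z]
    are [c (n-1) z (n-1) w (n-1) - c n (z n w (n+1) + w n z (n+1)) / 2].  After
    multiplication by [2 z n / 2 ^ n] the first of them cancels the last one of
    the preceding shell, which is what the weight is chosen for; the middle one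
    is non-positive.  What remains is
    [- c N (u N ^ 2 - v N ^ 2) (u (N+1) - v (N+1)) / 2 ^ N]. *)
Lemma weighted_balance (nu beta : R) (u v : nat -> R) (N : nat) :
  0 < nu -> (forall n, 0 <= u n) -> (forall n, 0 <= v n) ->
  total (fun n => / 2 ^ n * (2 * (u n - v n) * (field nu beta u n - field nu beta v n))) N
  <= / 2 ^ N * coef beta N * (u N ^ 2 * v (S N) + v N ^ 2 * u (S N)).
Proof.
  intros Hnu Hu Hv.
  assert (Hc : forall n, 0 <= / 2 ^ n * coef beta n).
  { intros n. apply Rmult_le_pos; [|apply coef_nonneg].
    apply Rlt_le, Rinv_0_lt_compat, pow_lt; lra. }
  apply Rle_trans with
    (- (/ 2 ^ N * coef beta N) * ((u N ^ 2 - v N ^ 2) * (u (S N) - v (S N)))).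
  - induction N as [|N IH].
    + simpl total. rewrite coef_0. lra.
    + rewrite total_S, !field_S.
      assert (H2 : / 2 ^ S N = / 2 * / 2 ^ N) by (simpl; rewrite Rinv_mult; reflexivity).
      assert (HcS := Hc (S N)). rewrite H2 in HcS |- *.
      assert (Hp : 0 < / 2 ^ N) by (apply Rinv_0_lt_compat, pow_lt; lra).
      set (p := / 2 ^ N) in *. set (bN := coef beta N) in *.
      set (bS := coef beta (S N)) in *.
      assert (Hz := pow2_ge_0 (u (S N) - v (S N))).
      assert (H3 : 0 <= / 2 * p * bS * ((u (S N) - v (S N))^2 * (u (S (S N)) + v (S (S N))))).
      { apply Rmult_le_pos; [exact HcS|]. apply Rmult_le_pos; [exact Hz|].
        assert (Ha := Hu (S (S N))). assert (Hb := Hv (S (S N))). lra. }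
      assert (H4 : 0 <= p * (nu * lambda (S N) ^ 2) * (u (S N) - v (S N)) ^ 2).
      { apply Rmult_le_pos; [|exact Hz]. apply Rmult_le_pos; [lra|].
        apply Rmult_le_pos; [lra|apply pow2_ge_0]. }
      nra.
  - assert (H1 := Hc N).
    assert (0 <= u N ^ 2 * u (S N) + v N ^ 2 * v (S N)).
    { assert (Ha := pow2_ge_0 (u N)). assert (Hb := pow2_ge_0 (v N)).
      assert (Hc' := Hu (S N)). assert (Hd := Hv (S N)).
      apply Rplus_le_le_0_compat; apply Rmult_le_pos; assumption. }
    nra.
Qed.

Definition leak (nu beta : R) (N : nat) : R :=
  / 2 ^ N * coef beta N / (2 * nu * lambda N ^ 2).

(** The flux through shell [N] in [weighted_balance] is at most
    [B c N (X N ^ 2 + Y N ^ 2) / 2 ^ N], and the two energies dissipate at least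
    [2 nu lambda N ^ 2 (X N ^ 2 + Y N ^ 2)].  Hence the weighted distance plus
    [B * leak] times the sum of the energies does not increase. *)
Lemma comparison (nu beta B E : R) (N : nat) (X Y : nat -> R -> R) (t : R) :
  0 < nu -> (1 <= N)%nat -> flow nu beta N X -> flow nu beta N Y -> 0 <= t ->
  (forall n, (1 <= n <= N)%nat -> X n 0 = Y n 0) ->
  energy X N 0 <= E -> 0 <= B ->
  (forall r, 0 <= r -> X (S N) r <= B) -> (forall r, 0 <= r -> Y (S N) r <= B) ->
  total (fun n => / 2 ^ n * (X n t - Y n t) ^ 2) N <= 2 * E * (B * leak nu beta N).
Proof.
  intros Hnu HN HX HY Ht H0 HE HB HXB HYB.
  set (K := B * leak nu beta N).
  set (Phi := fun r => total (fun n => / 2 ^ n * (X n r - Y n r) ^ 2) N).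
  assert (Hl := lambda_sq_pos N HN).
  assert (HK0 : 0 <= / 2 ^ N * coef beta N).
  { apply Rmult_le_pos; [|apply coef_nonneg].
    apply Rlt_le, Rinv_0_lt_compat, pow_lt; lra. }
  assert (HK : 0 <= K).
  { unfold K, leak. apply Rmult_le_pos; [exact HB|]. apply Rmult_le_pos; [exact HK0|].
    apply Rlt_le, Rinv_0_lt_compat. nra. }
  assert (HK2 : K * (2 * nu * lambda N ^ 2) = / 2 ^ N * coef beta N * B).
  { unfold K, leak. field.
    split; [apply pow_nonzero; lra|].
    split; [|lra]. intros Hz. rewrite Hz in Hl. lra. }
  assert (HY0 : energy Y N 0 <= E).
  { replace (energy Y N 0) with (energy X N 0); [exact HE|].
    apply total_ext. intros n Hn. cbv beta. rewrite (H0 n Hn). reflexivity. }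
  assert (HP0 : Phi 0 = 0).
  { apply eq_trans with (total (fun _ => 0) N); [apply total_ext|apply total_zero].
    intros n Hn. cbv beta. rewrite (H0 n Hn). ring. }
  assert (Hfin : Phi t + K * (energy X N t + energy Y N t)
                 <= Phi 0 + K * (energy X N 0 + energy Y N 0)).
  { apply (nonincreasing (fun r => Phi r + K * (energy X N r + energy Y N r))
       (fun r => total (fun n => / 2 ^ n * (2 * (X n r - Y n r) *
             (field nu beta (fun m => X m r) n - field nu beta (fun m => Y m r) n))) N
          + K * (Derive (energy X N) r + Derive (energy Y N) r))); [exact Ht| | |].
    - intros r.
      assert (HcX := flow_continuous _ _ _ _ HX). assert (HcY := flow_continuous _ _ _ _ HY).
      assert (continuous Phi r).
      { apply (total_continuous (fun n r => / 2 ^ n * (X n r - Y n r) ^ 2)).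
        intros n. continuity. }
      assert (continuous (energy X N) r) by (apply energy_continuous, HcX).
      assert (continuous (energy Y N) r) by (apply energy_continuous, HcY).
      continuity.
    - intros r Hr.
      destruct (derive_exists _ _ _ (energy_derive _ _ X N r HX ltac:(lra))) as [HdX _].
      destruct (derive_exists _ _ _ (energy_derive _ _ Y N r HY ltac:(lra))) as [HdY _].
      apply is_derive_Rplus.
      + apply (total_derive (fun n r => / 2 ^ n * (X n r - Y n r) ^ 2)). intros n Hn.
        assert (Ha := flow_derive _ _ _ _ HX n r Hn ltac:(lra)).
        assert (Hb := flow_derive _ _ _ _ HY n r Hn ltac:(lra)).
        eapply is_derive_eq; [derivative|cbv beta; ring].
      + eapply is_derive_eq; [derivative|cbv beta; ring].
    - intros r Hr.
      destruct (derive_exists _ _ _ (energy_derive _ _ X N r HX ltac:(lra))) as [_ HdX].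
      destruct (derive_exists _ _ _ (energy_derive _ _ Y N r HY ltac:(lra))) as [_ HdY].
      assert (Hw := weighted_balance nu beta (fun m => X m r) (fun m => Y m r) N Hnu
                      (fun n => flow_nonneg _ _ _ _ HX n r)
                      (fun n => flow_nonneg _ _ _ _ HY n r)).
      cbv beta in Hw.
      assert (HeX : lambda N ^ 2 * X N r ^ 2 <= enstrophy X N r).
      { apply (term_le_total (fun n => lambda n ^ 2 * X n r ^ 2)); [lia|].
        intros n _. apply Rmult_le_pos; apply pow2_ge_0. }
      assert (HeY : lambda N ^ 2 * Y N r ^ 2 <= enstrophy Y N r).
      { apply (term_le_total (fun n => lambda n ^ 2 * Y n r ^ 2)); [lia|].
        intros n _. apply Rmult_le_pos; apply pow2_ge_0. }
      assert (Hflux : / 2 ^ N * coef beta N * (X N r ^ 2 * Y (S N) r + Y N r ^ 2 * X (S N) r)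
                <= K * (2 * nu * lambda N ^ 2) * (X N r ^ 2 + Y N r ^ 2)).
      { rewrite HK2. rewrite (Rmult_assoc _ B). apply Rmult_le_compat_l; [exact HK0|].
        assert (Ha := pow2_ge_0 (X N r)). assert (Hb := pow2_ge_0 (Y N r)).
        assert (Hc := HXB r ltac:(lra)). assert (Hd := HYB r ltac:(lra)). nra. }
      assert (Hd : K * (Derive (energy X N) r + Derive (energy Y N) r)
              <= K * (- 2 * nu * (lambda N ^ 2 * X N r ^ 2 + lambda N ^ 2 * Y N r ^ 2))).
      { apply Rmult_le_compat_l; [exact HK|]. nra. }
      lra. }
  rewrite HP0 in Hfin. fold (Phi t).
  assert (HeX : 0 <= energy X N t).
  { apply total_nonneg. intros n _. apply pow2_ge_0. }
  assert (HeY : 0 <= energy Y N t).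
  { apply total_nonneg. intros n _. apply pow2_ge_0. }
  nra.
Qed.

Lemma comparison_component (nu beta B E : R) (n N : nat) (X Y : nat -> R -> R) (t : R) :
  0 < nu -> (1 <= n <= N)%nat -> flow nu beta N X -> flow nu beta N Y -> 0 <= t ->
  (forall n, (1 <= n <= N)%nat -> X n 0 = Y n 0) ->
  energy X N 0 <= E -> 0 <= B ->
  (forall r, 0 <= r -> X (S N) r <= B) -> (forall r, 0 <= r -> Y (S N) r <= B) ->
  (X n t - Y n t) ^ 2 <= 2 ^ n * (2 * E * B) * leak nu beta N.
Proof.
  intros Hnu Hn HX HY Ht H0 HE HB HXB HYB.
  assert (Hc := comparison nu beta B E N X Y t Hnu ltac:(lia) HX HY Ht H0 HE HB HXB HYB).
  assert (Hp : 0 < 2 ^ n) by (apply pow_lt; lra).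
  assert (Hterm : / 2 ^ n * (X n t - Y n t) ^ 2
             <= total (fun n => / 2 ^ n * (X n t - Y n t) ^ 2) N).
  { apply (term_le_total (fun n => / 2 ^ n * (X n t - Y n t) ^ 2)); [exact Hn|].
    intros m _. apply Rmult_le_pos; [|apply pow2_ge_0].
    apply Rlt_le, Rinv_0_lt_compat, pow_lt; lra. }
  replace ((X n t - Y n t) ^ 2) with (2 ^ n * (/ 2 ^ n * (X n t - Y n t) ^ 2))
    by (field; lra).
  apply Rle_trans with (2 ^ n * (2 * E * (B * leak nu beta N))); [|lra].
  apply Rmult_le_compat_l; lra.
Qed.

Lemma leak_pw (nu beta : R) (N : nat) :
  0 < nu -> (1 <= N)%nat -> leak nu beta N = Rpower 2 (beta - 3) ^ N / (2 * nu).
Proof.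
  intros Hnu HN. unfold leak. rewrite <- pw_pow, coef_pw, lambda_sq_pw by exact HN.
  replace (beta - 3) with (beta + - (1 + 2)) by ring.
  assert (H12 : pw (- (1 + 2)) N = / (pw 1 N * pw 2 N)).
  { rewrite <- pw_plus. unfold pw. rewrite <- Rpower_Ropp. f_equal. ring. }
  rewrite pw_plus, H12.
  replace (2 ^ N) with (pw 1 N) by (rewrite pw_pow, Rpower_1 by lra; reflexivity).
  assert (H1 := pw_pos 1 N). assert (H2 := pw_pos 2 N). field. repeat split; lra.
Qed.

(** This is where the exponent of the nonlinearity enters the comparison: the
    weight [2 ^ - N] and the dissipation [lambda N ^ 2] beat a transfer rate
    [lambda N ^ beta] as long as [beta < 3]. *)
Lemma leak_vanishes (nu beta C : R) :
  0 < nu -> beta < 3 -> forall eps, 0 < eps ->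
  exists N0, forall N, (N0 <= N)%nat -> (1 <= N)%nat -> C * leak nu beta N < eps.
Proof.
  intros Hnu Hb eps Heps.
  assert (Hr : Rabs (Rpower 2 (beta - 3)) < 1).
  { rewrite Rabs_right by (apply Rle_ge, Rlt_le, exp_pos).
    rewrite <- (Rpower_O 2) by lra. apply Rpower_lt; lra. }
  assert (Hq : 0 < eps * (2 * nu) / (Rabs C + 1)).
  { assert (H := Rabs_pos C). apply Rdiv_lt_0_compat; nra. }
  destruct (pow_lt_1_zero _ Hr _ Hq) as [N0 HN0].
  exists N0. intros N HN HN1. rewrite leak_pw by assumption.
  specialize (HN0 N HN). assert (HC := Rabs_pos C). assert (HC2 := Rle_abs C).
  assert (Hp : 0 < Rpower 2 (beta - 3) ^ N) by (apply pow_lt, exp_pos).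
  rewrite Rabs_right in HN0 by lra.
  set (p := Rpower 2 (beta - 3) ^ N) in *.
  assert (p * (Rabs C + 1) < eps * (2 * nu)).
  { apply Rmult_lt_compat_r with (r := Rabs C + 1) in HN0; [|lra].
    unfold Rdiv in HN0. rewrite Rmult_assoc, Rinv_l in HN0; lra. }
  replace (C * (p / (2 * nu))) with (C * p / (2 * nu)) by (field; lra).
  apply Rlt_div_l; [lra|]. nra.
Qed.

(** * Uniform limits of integral equations *)

Definition converges_uniformly (u : nat -> R -> R) (v : R -> R) : Prop :=
  forall T eps, 0 < eps ->
  exists K, forall k, (K <= k)%nat -> forall t, 0 <= t <= T -> Rabs (u k t - v t) <= eps.

Lemma uniform_limit (u : nat -> R -> R) :
  (forall k t, continuous (u k) t) ->
  (forall T eps, 0 < eps -> exists K, forall k, (K <= k)%nat ->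
     forall t, 0 <= t <= T -> Rabs (u k t - u K t) <= eps) ->
  exists v, (forall t, continuous v t) /\ (forall t, v t = v (Rmax 0 t)) /\
            converges_uniformly u v.
Proof.
  intros Hc HC.
  set (v := fun t => real (Lim_seq (fun k => u k (Rmax 0 t)))).
  assert (Hv : forall t, 0 <= t -> is_lim_seq (fun k => u k t) (v t)).
  { intros t Ht. unfold v. rewrite Rmax_right by exact Ht. apply Lim_seq_correct'.
    apply ex_lim_seq_cauchy_corr. intros eps.
    destruct (HC t (eps / 3)) as [K HK]; [destruct eps; simpl; lra|].
    exists K. intros n m Hn Hm.
    assert (H1 := HK n Hn t ltac:(lra)). assert (H2 := HK m Hm t ltac:(lra)).
    assert (He := cond_pos eps).
    apply Rabs_le_between in H1. apply Rabs_le_between in H2.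
    apply Rabs_lt_between. lra. }
  assert (Hcv : converges_uniformly u v).
  { intros T eps Heps. destruct (HC T (eps / 4)) as [K HK]; [lra|].
    exists K. intros k Hk t Ht.
    assert (Hl := Hv t ltac:(lra)). apply is_lim_seq_spec in Hl.
    destruct (Hl (mkposreal (eps / 4) ltac:(lra))) as [J HJ].
    specialize (HJ (max J K) ltac:(lia)). simpl in HJ.
    assert (H1 := HK k Hk t Ht). assert (H2 := HK (max J K) ltac:(lia) t Ht).
    apply Rabs_le_between in H1. apply Rabs_le_between in H2.
    apply Rabs_lt_between in HJ. apply Rabs_le_between. lra. }
  exists v. split; [|split; [|exact Hcv]].
  - intros t. apply continuous_of_eps. intros eps Heps.
    destruct (Hcv (Rmax 0 t + 1) (eps / 4)) as [K HK]; [lra|].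
    destruct (continuous_eps (u K) (Rmax 0 t) (Hc K _) (eps / 4)) as [d [Hd Hn]]; [lra|].
    exists (Rmin d 1). split; [apply Rmin_pos; lra|]. intros y Hy.
    assert (Hm1 := Rmin_l d 1). assert (Hm2 := Rmin_r d 1).
    assert (Hr := Rmax_lipschitz t y).
    assert (H1 := Hn (Rmax 0 y) ltac:(lra)).
    assert (Hry : Rmax 0 y <= Rmax 0 t + 1).
    { assert (H := Rabs_def2 (Rmax 0 y - Rmax 0 t) 1 ltac:(lra)). lra. }
    assert (Hy0 := Rmax_l 0 y). assert (Ht0 := Rmax_l 0 t).
    assert (H2 := HK K (le_n K) (Rmax 0 y) ltac:(lra)).
    assert (H3 := HK K (le_n K) (Rmax 0 t) ltac:(lra)).
    assert (Hp : forall r, v r = v (Rmax 0 r)).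
    { intros r. unfold v. rewrite (Rmax_right 0 (Rmax 0 r)) by apply Rmax_l. reflexivity. }
    rewrite (Hp y), (Hp t).
    apply Rabs_lt_between in H1. apply Rabs_le_between in H2. apply Rabs_le_between in H3.
    apply Rabs_lt_between. lra.
  - intros t. unfold v. rewrite (Rmax_right 0 (Rmax 0 t)) by apply Rmax_l. reflexivity.
Qed.

Lemma converges_uniformly_at (u : nat -> R -> R) (v : R -> R) (t : R) :
  converges_uniformly u v -> 0 <= t -> is_lim_seq (fun k => u k t) (v t).
Proof.
  intros H Ht. apply is_lim_seq_spec. intros eps.
  destruct (H t (eps / 2)) as [K HK]; [destruct eps; simpl; lra|].
  exists K. intros n Hn. assert (H1 := HK n Hn t ltac:(lra)).
  assert (He := cond_pos eps). lra.
Qed.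

Lemma integrable (f : R -> R) (a b : R) : (forall t, continuous f t) -> ex_RInt f a b.
Proof. intros H. apply (ex_RInt_continuous (V := R_CompleteNormedModule)). intros; apply H. Qed.

Lemma integral_equation_limit (u f : nat -> R -> R) (v g : R -> R) (x : R) :
  (forall k t, continuous (f k) t) -> (forall t, continuous g t) ->
  converges_uniformly u v -> converges_uniformly f g ->
  (exists K, forall k, (K <= k)%nat -> forall t, 0 <= t -> u k t = x + RInt (f k) 0 t) ->
  forall t, 0 <= t -> v t = x + RInt g 0 t.
Proof.
  intros Hf Hg Hu Hfg [K HK] t Ht.
  apply Rminus_diag_uniq. apply Rabs_eq_0.
  apply Rle_antisym; [|apply Rabs_pos].
  apply le_epsilon. intros eps Heps.
  destruct (Hu t (eps / 2)) as [K1 H1]; [lra|].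
  destruct (Hfg t (eps / 2 / (t + 1))) as [K2 H2]; [apply Rdiv_lt_0_compat; lra|].
  set (k := max K (max K1 K2)).
  assert (Ha := H1 k ltac:(lia) t ltac:(lra)).
  rewrite (HK k ltac:(lia) t Ht) in Ha.
  assert (Hb : Rabs (RInt (fun s => f k s - g s) 0 t) <= (t - 0) * (eps / 2 / (t + 1))).
  { apply abs_RInt_le_const; [exact Ht| |].
    - apply integrable. intros s. continuity.
    - intros s Hs. apply H2; [lia|exact Hs]. }
  assert (Hm : RInt (fun s => f k s - g s) 0 t = RInt (f k) 0 t - RInt g 0 t).
  { apply (RInt_minus (V := R_CompleteNormedModule)); apply integrable; auto. }
  rewrite Hm in Hb.
  assert (Hq : (t - 0) * (eps / 2 / (t + 1)) <= eps / 2).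
  { replace ((t - 0) * (eps / 2 / (t + 1))) with (eps / 2 * (t / (t + 1))) by (field; lra).
    assert (t / (t + 1) <= 1) by (apply Rle_div_l; lra). nra. }
  apply Rabs_le_between in Ha. apply Rabs_le_between in Hb.
  apply Rabs_le_between. lra.
Qed.

Lemma primitive_derive (f : R -> R) (x t : R) :
  (forall s, continuous f s) -> is_derive (fun r => x + RInt f 0 r) t (f t).
Proof.
  intros Hf. apply (is_derive_eq _ _ _ (0 + f t)); [|ring].
  apply is_derive_Rplus; [apply is_derive_Rconst|].
  apply (is_derive_RInt (V := R_NormedModule) f (RInt f 0) 0 t); [|apply Hf].
  apply filter_forall. intros r.
  apply (RInt_correct (V := R_CompleteNormedModule)), integrable, Hf.
Qed.

Lemma integral_equation_derive (u f : R -> R) (x : R) :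
  (forall s, continuous f s) -> (forall t, 0 <= t -> u t = x + RInt f 0 t) ->
  forall t, 0 < t -> is_derive u t (f t).
Proof.
  intros Hf Hu t Ht.
  apply (is_derive_ext_loc (fun r => x + RInt f 0 r)); [|apply primitive_derive, Hf].
  exists (mkposreal t Ht). intros y Hy.
  symmetry. apply Hu.
  assert (H : Rabs (y - t) < t) by exact Hy. apply Rabs_def2 in H. lra.
Qed.

Lemma dominated (f df g dg : R -> R) (t : R) :
  0 <= t -> (forall r, continuous f r) -> (forall r, continuous g r) ->
  (forall r, 0 < r < t -> is_derive f r (df r)) ->
  (forall r, 0 < r < t -> is_derive g r (dg r)) ->
  (forall r, 0 < r < t -> Rabs (df r) <= dg r) ->
  Rabs (f 0) <= g 0 -> Rabs (f t) <= g t.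
Proof.
  intros Ht Hf Hg Hdf Hdg Hle H0.
  apply Rabs_le_between in H0.
  assert (H1 : f t - g t <= f 0 - g 0).
  { apply (nonincreasing (fun r => f r - g r) (fun r => df r - dg r)); [exact Ht| | |].
    - intros r. continuity.
    - intros r Hr. apply is_derive_Rminus; auto.
    - intros r Hr. specialize (Hle r Hr). apply Rabs_le_between in Hle. lra. }
  assert (H2 : - f t - g t <= - f 0 - g 0).
  { apply (nonincreasing (fun r => - f r - g r) (fun r => - df r - dg r)); [exact Ht| | |].
    - intros r. continuity.
    - intros r Hr. apply is_derive_Rminus; [apply is_derive_Ropp|]; auto.
    - intros r Hr. specialize (Hle r Hr). apply Rabs_le_between in Hle. lra. }
  apply Rabs_le_between. lra.
Qed.

(** * Picard iteration for nearest-neighbour systems *)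

(** Dependence on the neighbours only, rather than on a sup norm, is what allows
    limits to be taken component by component. *)
Definition local_lipschitz (F : (nat -> R) -> nat -> R) (n : nat) (L : R) : Prop :=
  forall u v, Rabs (F u n - F v n) <=
    L * (Rabs (u (n - 1)%nat - v (n - 1)%nat) + Rabs (u n - v n)
         + Rabs (u (n + 1)%nat - v (n + 1)%nat)).

Lemma local_lipschitz_modulus F n L :
  local_lipschitz F n L -> forall eps, 0 < eps ->
  exists e, 0 < e /\ forall u v : nat -> R,
    Rabs (u (n - 1)%nat - v (n - 1)%nat) <= e -> Rabs (u n - v n) <= e ->
    Rabs (u (n + 1)%nat - v (n + 1)%nat) <= e -> Rabs (F u n - F v n) < eps.
Proof.
  intros HL eps Heps.
  assert (HL0 := Rabs_pos L). assert (HL1 := Rle_abs L).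
  exists (eps / (3 * Rabs L + 1)).
  assert (He : 0 < eps / (3 * Rabs L + 1)) by (apply Rdiv_lt_0_compat; lra).
  assert (Heq : (3 * Rabs L + 1) * (eps / (3 * Rabs L + 1)) = eps) by (field; lra).
  set (e := eps / (3 * Rabs L + 1)) in *.
  split; [exact He|]. intros u v H1 H2 H3.
  eapply Rle_lt_trans; [apply HL|].
  set (S := Rabs (u (n - 1)%nat - v (n - 1)%nat) + Rabs (u n - v n)
            + Rabs (u (n + 1)%nat - v (n + 1)%nat)).
  assert (HS : 0 <= S) by (unfold S; repeat apply Rplus_le_le_0_compat; apply Rabs_pos).
  assert (HS3 : S <= 3 * e) by (unfold S; lra).
  apply Rle_lt_trans with (Rabs L * (3 * e)); [|lra].
  apply Rle_trans with (Rabs L * S); [apply Rmult_le_compat_r; lra|].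
  apply Rmult_le_compat_l; lra.
Qed.

Lemma local_lipschitz_continuous F n L (u : nat -> R -> R) (t : R) :
  local_lipschitz F n L -> (forall m t, continuous (u m) t) ->
  continuous (fun s => F (fun m => u m s) n) t.
Proof.
  intros HL Hc. apply continuous_of_eps. intros eps Heps.
  destruct (local_lipschitz_modulus F n L HL eps Heps) as [e [He HF]].
  destruct (continuous_eps _ _ (Hc (n - 1)%nat t) e He) as [d1 [Hd1 H1]].
  destruct (continuous_eps _ _ (Hc n t) e He) as [d2 [Hd2 H2]].
  destruct (continuous_eps _ _ (Hc (n + 1)%nat t) e He) as [d3 [Hd3 H3]].
  exists (Rmin d1 (Rmin d2 d3)). split; [repeat apply Rmin_pos; assumption|].
  intros y Hy.
  assert (Hm1 := Rmin_l d1 (Rmin d2 d3)). assert (Hm2 := Rmin_r d1 (Rmin d2 d3)).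
  assert (Hm3 := Rmin_l d2 d3). assert (Hm4 := Rmin_r d2 d3).
  apply HF; apply Rlt_le; [apply H1|apply H2|apply H3]; lra.
Qed.

Lemma local_lipschitz_converges F n L (u : nat -> nat -> R -> R) (v : nat -> R -> R) :
  local_lipschitz F n L -> (forall m, converges_uniformly (fun k => u k m) (v m)) ->
  converges_uniformly (fun k s => F (fun m => u k m s) n) (fun s => F (fun m => v m s) n).
Proof.
  intros HL Hu T eps Heps.
  destruct (local_lipschitz_modulus F n L HL eps Heps) as [e [He HF]].
  destruct (Hu (n - 1)%nat T e He) as [K1 H1].
  destruct (Hu n T e He) as [K2 H2].
  destruct (Hu (n + 1)%nat T e He) as [K3 H3].
  exists (max K1 (max K2 K3)). intros k Hk t Ht. apply Rlt_le.
  apply HF; [apply H1|apply H2|apply H3]; (lia || exact Ht).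
Qed.

Fixpoint picard (F : (nat -> R) -> nat -> R) (x : nat -> R) (k n : nat) (t : R) : R :=
  match k with
  | O => x n
  | S k => x n + RInt (fun s => F (fun m => picard F x k m s) n) 0 t
  end.

Lemma half_pow_small (C eps : R) : 0 < eps -> exists K, C * (/ 2) ^ K <= eps.
Proof.
  intros Heps.
  assert (Hq : 0 < eps / (Rabs C + 1)).
  { assert (H := Rabs_pos C). apply Rdiv_lt_0_compat; lra. }
  destruct (pow_lt_1_zero (/ 2) ltac:(rewrite Rabs_right; lra) _ Hq) as [K HK].
  exists K. specialize (HK K (le_n K)).
  assert (Hp : 0 < (/ 2) ^ K) by (apply pow_lt; lra).
  rewrite Rabs_right in HK by lra.
  assert (HC := Rabs_pos C). assert (HC1 := Rle_abs C).
  assert (Heq : (Rabs C + 1) * (eps / (Rabs C + 1)) = eps) by (field; lra).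
  set (q := eps / (Rabs C + 1)) in *. nra.
Qed.

(** Consecutive iterates differ by at most [C * (1/2) ^ k * exp (6 L t)], uniformly
    in the component.  A nearest-neighbour Lipschitz bound multiplies such an
    estimate by [3 L], and the integration in time of the exponential divides it
    by [6 L]: this gives the factor one half on the whole half-line, with no
    restriction on the length of the time interval. *)
Lemma picard_solution (F : (nat -> R) -> nat -> R) (x : nat -> R) (L A : R) :
  0 < L -> (forall n, local_lipschitz F n L) -> (forall n, Rabs (F x n) <= A) ->
  exists u : nat -> R -> R,
    (forall n t, continuous (u n) t) /\ (forall n t, u n t = u n (Rmax 0 t)) /\
    (forall n t, 0 <= t -> u n t = x n + RInt (fun s => F (fun m => u m s) n) 0 t).
Proof.
  intros HL HF HA.
  assert (HA0 : 0 <= A) by (eapply Rle_trans; [apply Rabs_pos|apply (HA O)]).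
  assert (Hcont : forall k n t, continuous (picard F x k n) t).
  { induction k as [|k IH]; intros n t; simpl; [apply continuous_const|].
    eapply derive_continuous, primitive_derive.
    intros s. apply (local_lipschitz_continuous F n L); [apply HF|exact IH]. }
  assert (HFc : forall k n t, continuous (fun s => F (fun m => picard F x k m s) n) t).
  { intros k n t. apply (local_lipschitz_continuous F n L); [apply HF|apply Hcont]. }
  set (C := A / (3 * L)).
  assert (HC : 0 <= C) by (apply Rdiv_le_0_compat; lra).
  assert (HCA : 3 * L * C = A) by (unfold C; field; lra).
  assert (Hstep : forall k n t, 0 <= t ->
     Rabs (picard F x (S k) n t - picard F x k n t) <= C * (/ 2) ^ k * exp (6 * L * t)).
  { assert (HgD : forall k r, is_derive (fun r => C * (/ 2) ^ k * exp (6 * L * r)) r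
                    (2 * A * (/ 2) ^ k * exp (6 * L * r))).
    { intros k r. eapply is_derive_eq; [derivative|cbv beta; rewrite <- HCA; ring]. }
    assert (Hg0 : forall k, 0 <= C * (/ 2) ^ k * exp (6 * L * 0)).
    { intros k. apply Rmult_le_pos; [apply Rmult_le_pos|].
      - exact HC.
      - apply pow_le; lra.
      - apply Rlt_le, exp_pos. }
    assert (Hz : forall k n, picard F x k n 0 = x n).
    { intros [|k] n; simpl; [reflexivity|].
      rewrite RInt_point. unfold zero; simpl. ring. }
    induction k as [|k IH]; intros n t Ht.
    - apply (dominated (fun r => picard F x 1 n r - picard F x 0 n r)
               (fun r => F x n - 0) (fun r => C * (/ 2) ^ 0 * exp (6 * L * r))
               (fun r => 2 * A * (/ 2) ^ 0 * exp (6 * L * r))); [exact Ht| | | | | |].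
      + intros r. assert (H1 := Hcont 1%nat n r). assert (H2 := Hcont O n r). continuity.
      + intros r. continuity.
      + intros r Hr. apply is_derive_Rminus.
        * apply (primitive_derive (fun s => F x n)). intros s. apply continuous_const.
        * apply is_derive_Rconst.
      + intros r Hr. apply HgD.
      + intros r Hr. rewrite Rminus_0_r. eapply Rle_trans; [apply HA|].
        assert (He : 1 < exp (6 * L * r)) by (rewrite <- exp_0; apply exp_increasing; nra).
        simpl. nra.
      + rewrite !Hz, Rminus_diag, Rabs_R0. apply Hg0.
    - apply (dominated (fun r => picard F x (S (S k)) n r - picard F x (S k) n r)
               (fun r => F (fun m => picard F x (S k) m r) n - F (fun m => picard F x k m r) n)
               (fun r => C * (/ 2) ^ S k * exp (6 * L * r))
               (fun r => 2 * A * (/ 2) ^ S k * exp (6 * L * r))); [exact Ht| | | | | |].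
      + intros r. assert (H1 := Hcont (S (S k)) n r). assert (H2 := Hcont (S k) n r). continuity.
      + intros r. continuity.
      + intros r Hr. apply is_derive_Rminus.
        * apply (primitive_derive (fun s => F (fun m => picard F x (S k) m s) n)), HFc.
        * apply (primitive_derive (fun s => F (fun m => picard F x k m s) n)), HFc.
      + intros r Hr. apply HgD.
      + intros r Hr. eapply Rle_trans; [apply HF|].
        assert (H1 := IH (n - 1)%nat r ltac:(lra)). assert (H2 := IH n r ltac:(lra)).
        assert (H3 := IH (n + 1)%nat r ltac:(lra)).
        replace (2 * A * (/ 2) ^ S k * exp (6 * L * r))
          with (L * (3 * (C * (/ 2) ^ k * exp (6 * L * r))))
          by (rewrite <- HCA; simpl; field).
        apply Rmult_le_compat_l; lra.
      + rewrite !Hz, Rminus_diag, Rabs_R0. apply Hg0. }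
  assert (Hlim : forall n, exists v, (forall t, continuous v t) /\
            (forall t, v t = v (Rmax 0 t)) /\
            converges_uniformly (fun k => picard F x k n) v).
  { intros n. apply uniform_limit; [intros k; apply Hcont|].
    intros T eps Heps.
    set (D := C * exp (6 * L * T)).
    destruct (half_pow_small (2 * D) eps Heps) as [K HK].
    exists K. intros k Hk t Ht.
    assert (HD : forall j, Rabs (picard F x (S j) n t - picard F x j n t) <= D * (/ 2) ^ j).
    { intros j. eapply Rle_trans; [apply Hstep; lra|].
      assert (exp (6 * L * t) <= exp (6 * L * T)).
      { destruct (Req_dec t T) as [<-|Hne]; [lra|].
        apply Rlt_le, exp_increasing. nra. }
      assert (0 < (/ 2) ^ j) by (apply pow_lt; lra).
      unfold D. replace (C * exp (6 * L * T) * (/ 2) ^ j)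
        with (C * (/ 2) ^ j * exp (6 * L * T)) by ring.
      apply Rmult_le_compat_l; [apply Rmult_le_pos; lra|assumption]. }
    assert (Hsum : Rabs (picard F x k n t - picard F x K n t)
                   <= 2 * D * (/ 2) ^ K - 2 * D * (/ 2) ^ k).
    { induction Hk as [|k Hk IH].
      - rewrite Rminus_diag, Rabs_R0. lra.
      - specialize (HD k). apply Rabs_le_between in HD. apply Rabs_le_between in IH.
        apply Rabs_le_between. change ((/ 2) ^ S k) with (/ 2 * (/ 2) ^ k). lra. }
    assert (0 <= D) by (apply Rmult_le_pos; [exact HC|apply Rlt_le, exp_pos]).
    assert (0 < (/ 2) ^ k) by (apply pow_lt; lra). nra. }
  destruct (functional_choice _ Hlim) as [u Hu].
  exists u. split; [intros n; apply (Hu n)|]. split; [intros n; apply (Hu n)|].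
  intros n.
  apply (integral_equation_limit (fun k => picard F x (S k) n)
           (fun k s => F (fun m => picard F x k m s) n)).
  - intros k t. apply HFc.
  - intros t. apply (local_lipschitz_continuous F n L); [apply HF|intros m; apply (Hu m)].
  - intros T eps Heps. destruct (proj2 (proj2 (Hu n)) T eps Heps) as [K HK].
    exists K. intros k Hk. apply HK. lia.
  - apply (local_lipschitz_converges F n L); [apply HF|intros m; apply (Hu m)].
  - exists O. intros k _ t _. reflexivity.
Qed.

(** * Galerkin approximations *)

Definition clamp (B r : R) : R := Rmin B (Rmax 0 r).

Lemma clamp_range (B r : R) : 0 <= B -> 0 <= clamp B r <= B.
Proof.
  intros HB. unfold clamp, Rmin, Rmax.
  destruct (Rle_dec 0 r), (Rle_dec B _); lra.
Qed.

Lemma clamp_id (B r : R) : 0 <= r <= B -> clamp B r = r.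
Proof. intros H. unfold clamp. rewrite Rmax_right, Rmin_right; lra. Qed.

Lemma clamp_neg (B r : R) : 0 <= B -> r <= 0 -> clamp B r = 0.
Proof. intros HB H. unfold clamp. rewrite Rmax_left, Rmin_right; lra. Qed.

Lemma clamp_large (B r : R) : 0 <= B <= r -> clamp B r = B.
Proof. intros H. unfold clamp. rewrite Rmax_right, Rmin_left; lra. Qed.

Lemma clamp_lipschitz (B r s : R) : 0 <= B -> Rabs (clamp B r - clamp B s) <= Rabs (r - s).
Proof.
  intros HB. unfold clamp, Rmin, Rmax.
  destruct (Rle_dec 0 r), (Rle_dec 0 s);
    repeat match goal with |- context [Rle_dec B ?a] => destruct (Rle_dec B a) end;
    unfold Rabs;
    repeat match goal with |- context [Rcase_abs ?a] => destruct (Rcase_abs a) end; lra.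
Qed.

(** The clamp makes the quadratic terms Lipschitz, so that Picard iteration
    applies. *)
Definition clamped_field (nu beta B : R) (u : nat -> R) (n : nat) : R :=
  - nu * lambda n ^ 2 * u n + coef beta (n - 1) * clamp B (u (n - 1)%nat) ^ 2
  - coef beta n * clamp B (u n) * clamp B (u (n + 1)%nat).

(** The primitive of the clamp.  As an energy density it replaces [r ^ 2 / 2]: with
    the multiplier [clamp B (u n)] instead of [u n], the clamped transfers still
    telescope. *)
Definition clamp_primitive (B r : R) : R := r * clamp B r - clamp B r ^ 2 / 2.

Lemma clamp_primitive_derive (B r : R) :
  0 <= B -> is_derive (clamp_primitive B) r (clamp B r).
Proof.
  intros HB.
  assert (Hq : forall s, Rabs (clamp_primitive B s - clamp_primitive B r
                               - clamp B r * (s - r)) <= (s - r) ^ 2).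
  { intros s. unfold clamp_primitive. apply Rabs_le_between.
    destruct (Rle_or_lt r 0) as [Hr|Hr]; [rewrite (clamp_neg B r) by lra|
      destruct (Rle_or_lt r B) as [Hr'|Hr'];
        [rewrite (clamp_id B r) by lra|rewrite (clamp_large B r) by lra]];
    (destruct (Rle_or_lt s 0) as [Hs|Hs]; [rewrite (clamp_neg B s) by lra|
      destruct (Rle_or_lt s B) as [Hs'|Hs'];
        [rewrite (clamp_id B s) by lra|rewrite (clamp_large B s) by lra]]);
    assert (Hsq := pow2_ge_0 (s - r)); split; first [nra | assert (0 <= - r * s) by nra; nra]. }
  apply is_derive_Reals. intros eps Heps.
  exists (mkposreal eps Heps). intros h Hh Hhe. simpl in Hhe.
  specialize (Hq (r + h)). replace (r + h - r) with h in Hq by ring.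
  set (D := clamp_primitive B (r + h) - clamp_primitive B r) in *.
  replace (D / h - clamp B r) with ((D - clamp B r * h) / h) by (field; exact Hh).
  unfold Rdiv. rewrite Rabs_mult, Rabs_inv.
  assert (Ha := Rabs_pos_lt h Hh).
  apply Rle_lt_trans with (Rabs h); [|exact Hhe].
  apply Rle_div_l; [exact Ha|].
  rewrite <- Rabs_mult. rewrite (Rabs_right (h * h)) by (apply Rle_ge, Rle_0_sqr).
  replace (h * h) with (h ^ 2) by ring. exact Hq.
Qed.

Lemma clamp_mul_nonneg (B r : R) : 0 <= B -> 0 <= r * clamp B r.
Proof.
  intros HB. destruct (Rle_or_lt r 0) as [Hr|Hr].
  - rewrite clamp_neg by lra. lra.
  - assert (H := clamp_range B r HB). nra.
Qed.

Lemma clamped_field_S (nu beta B : R) (u : nat -> R) (n : nat) :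
  clamped_field nu beta B u (S n) =
  - nu * lambda (S n) ^ 2 * u (S n) + coef beta n * clamp B (u n) ^ 2
  - coef beta (S n) * clamp B (u (S n)) * clamp B (u (S (S n))).
Proof.
  unfold clamped_field. replace (S n - 1)%nat with n by lia.
  replace (S n + 1)%nat with (S (S n)) by lia. reflexivity.
Qed.

Lemma clamped_balance (nu beta B : R) (u : nat -> R) (N : nat) :
  0 < nu -> 0 <= B ->
  total (fun n => clamp B (u n) * clamped_field nu beta B u n) N <= 0.
Proof.
  intros Hnu HB.
  apply Rle_trans with (- coef beta N * clamp B (u N) ^ 2 * clamp B (u (S N))).
  - induction N as [|N IH].
    + simpl total. rewrite coef_0. lra.
    + rewrite total_S, clamped_field_S.
      assert (H := clamp_mul_nonneg B (u (S N)) HB).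
      assert (H2 : 0 <= nu * lambda (S N) ^ 2 * (u (S N) * clamp B (u (S N)))).
      { apply Rmult_le_pos; [|exact H]. apply Rmult_le_pos; [lra|apply pow2_ge_0]. }
      lra.
  - assert (0 <= coef beta N * clamp B (u N) ^ 2 * clamp B (u (S N))); [|lra].
    apply Rmult_le_pos; [apply Rmult_le_pos|].
    + apply coef_nonneg.
    + apply pow2_ge_0.
    + apply clamp_range, HB.
Qed.

Definition clamped_constant (nu beta B : R) (n : nat) : R :=
  nu * lambda n ^ 2 + 2 * B * coef beta (n - 1) + B * coef beta n.

Lemma clamped_constant_nonneg (nu beta B : R) (n : nat) :
  0 < nu -> 0 <= B -> 0 <= clamped_constant nu beta B n.
Proof.
  intros Hnu HB. unfold clamped_constant.
  assert (H1 := coef_nonneg beta (n - 1)). assert (H2 := coef_nonneg beta n).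
  assert (H3 := pow2_ge_0 (lambda n)).
  assert (0 <= nu * lambda n ^ 2) by (apply Rmult_le_pos; lra).
  assert (0 <= B * coef beta (n - 1)) by (apply Rmult_le_pos; lra).
  assert (0 <= B * coef beta n) by (apply Rmult_le_pos; lra). lra.
Qed.

Lemma clamped_field_lipschitz (nu beta B : R) (n : nat) :
  0 < nu -> 0 <= B ->
  local_lipschitz (clamped_field nu beta B) n (clamped_constant nu beta B n).
Proof.
  intros Hnu HB u v. unfold clamped_field, clamped_constant.
  assert (H1 := coef_nonneg beta (n - 1)). assert (H2 := coef_nonneg beta n).
  assert (H3 : 0 <= nu * lambda n ^ 2) by (apply Rmult_le_pos; [lra|apply pow2_ge_0]).
  set (c1 := coef beta (n - 1)) in *. set (c2 := coef beta n) in *.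
  set (k := nu * lambda n ^ 2) in *.
  replace (- nu * lambda n ^ 2) with (- k) by (unfold k; ring).
  assert (HL0 := clamp_lipschitz B (u (n - 1)%nat) (v (n - 1)%nat) HB).
  assert (HL1 := clamp_lipschitz B (u n) (v n) HB).
  assert (HL2 := clamp_lipschitz B (u (n + 1)%nat) (v (n + 1)%nat) HB).
  assert (Hu0 := clamp_range B (u (n - 1)%nat) HB). assert (Hv0 := clamp_range B (v (n - 1)%nat) HB).
  assert (Hu2 := clamp_range B (u (n + 1)%nat) HB). assert (Hv1 := clamp_range B (v n) HB).
  set (a0 := clamp B (u (n - 1)%nat)) in *. set (b0 := clamp B (v (n - 1)%nat)) in *.
  set (a1 := clamp B (u n)) in *. set (b1 := clamp B (v n)) in *.
  set (a2 := clamp B (u (n + 1)%nat)) in *. set (b2 := clamp B (v (n + 1)%nat)) in *.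
  set (d0 := Rabs (u (n - 1)%nat - v (n - 1)%nat)) in *.
  set (d1 := Rabs (u n - v n)) in *.
  set (d2 := Rabs (u (n + 1)%nat - v (n + 1)%nat)) in *.
  assert (Hd0 : 0 <= d0) by apply Rabs_pos. assert (Hd1 : 0 <= d1) by apply Rabs_pos.
  assert (Hd2 : 0 <= d2) by apply Rabs_pos.
  replace (- k * u n + c1 * a0 ^ 2 - c2 * a1 * a2 - (- k * v n + c1 * b0 ^ 2 - c2 * b1 * b2))
    with (- k * (u n - v n) + (c1 * (a0 + b0)) * (a0 - b0)
          + (- c2 * a2 * (a1 - b1) + - c2 * b1 * (a2 - b2))) by ring.
  assert (E1 : Rabs (- k * (u n - v n)) <= k * d1).
  { rewrite Rabs_mult, Rabs_Ropp, (Rabs_right k) by lra. unfold d1. lra. }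
  assert (E2 : Rabs (c1 * (a0 + b0) * (a0 - b0)) <= 2 * B * c1 * d0).
  { assert (0 <= c1 * (a0 + b0)) by (apply Rmult_le_pos; lra).
    rewrite Rabs_mult, (Rabs_right (c1 * (a0 + b0))) by lra.
    apply Rmult_le_compat; [assumption|apply Rabs_pos|nra|assumption]. }
  assert (E3 : Rabs (- c2 * a2 * (a1 - b1)) <= B * c2 * d1).
  { replace (- c2 * a2 * (a1 - b1)) with (- ((c2 * a2) * (a1 - b1))) by ring.
    assert (0 <= c2 * a2) by (apply Rmult_le_pos; lra).
    rewrite Rabs_Ropp, Rabs_mult, (Rabs_right (c2 * a2)) by lra.
    apply Rmult_le_compat; [assumption|apply Rabs_pos|nra|assumption]. }
  assert (E4 : Rabs (- c2 * b1 * (a2 - b2)) <= B * c2 * d2).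
  { replace (- c2 * b1 * (a2 - b2)) with (- ((c2 * b1) * (a2 - b2))) by ring.
    assert (0 <= c2 * b1) by (apply Rmult_le_pos; lra).
    rewrite Rabs_Ropp, Rabs_mult, (Rabs_right (c2 * b1)) by lra.
    apply Rmult_le_compat; [assumption|apply Rabs_pos|nra|assumption]. }
  assert (T1 := Rabs_triang (- k * (u n - v n) + c1 * (a0 + b0) * (a0 - b0))
                  (- c2 * a2 * (a1 - b1) + - c2 * b1 * (a2 - b2))).
  assert (T2 := Rabs_triang (- k * (u n - v n)) (c1 * (a0 + b0) * (a0 - b0))).
  assert (T3 := Rabs_triang (- c2 * a2 * (a1 - b1)) (- c2 * b1 * (a2 - b2))).
  assert (0 <= k * d0) by (apply Rmult_le_pos; lra).
  assert (0 <= k * d2) by (apply Rmult_le_pos; lra).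
  assert (0 <= B * c1) by (apply Rmult_le_pos; lra).
  assert (0 <= B * c2) by (apply Rmult_le_pos; lra).
  assert (0 <= B * c1 * d1) by (apply Rmult_le_pos; lra).
  assert (0 <= B * c1 * d2) by (apply Rmult_le_pos; lra).
  assert (0 <= B * c2 * d0) by (apply Rmult_le_pos; lra).
  lra.
Qed.

Definition galerkin_field (nu beta B : R) (N : nat) (u : nat -> R) (n : nat) : R :=
  if andb (1 <=? n)%nat (n <=? N)%nat then clamped_field nu beta B u n else 0.

Lemma galerkin_field_inside nu beta B N u n :
  (1 <= n <= N)%nat -> galerkin_field nu beta B N u n = clamped_field nu beta B u n.
Proof.
  intros Hn. unfold galerkin_field.
  rewrite (proj2 (Nat.leb_le 1 n)), (proj2 (Nat.leb_le n N)) by lia. reflexivity.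
Qed.

Lemma galerkin_field_outside nu beta B N u n :
  ~ (1 <= n <= N)%nat -> galerkin_field nu beta B N u n = 0.
Proof.
  intros Hn. unfold galerkin_field.
  destruct (Nat.leb_spec 1 n), (Nat.leb_spec n N); simpl; try reflexivity. lia.
Qed.

Lemma galerkin_field_lipschitz nu beta B N n :
  0 < nu -> 0 <= B ->
  local_lipschitz (galerkin_field nu beta B N) n
    (1 + total (clamped_constant nu beta B) N).
Proof.
  intros Hnu HB u v.
  assert (Hc : forall m, 0 <= clamped_constant nu beta B m)
    by (intros m; apply clamped_constant_nonneg; assumption).
  assert (Ht : 0 <= total (clamped_constant nu beta B) N)
    by (apply total_nonneg; intros m _; apply Hc).
  assert (HS : 0 <= Rabs (u (n - 1)%nat - v (n - 1)%nat) + Rabs (u n - v n)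
         + Rabs (u (n + 1)%nat - v (n + 1)%nat))
    by (repeat apply Rplus_le_le_0_compat; apply Rabs_pos).
  destruct (classic (1 <= n <= N)%nat) as [Hn|Hn].
  - rewrite !galerkin_field_inside by exact Hn.
    eapply Rle_trans; [apply clamped_field_lipschitz; assumption|].
    apply Rmult_le_compat_r; [exact HS|].
    assert (H := term_le_total (clamped_constant nu beta B) n N Hn (fun m _ => Hc m)). lra.
  - rewrite !galerkin_field_outside by exact Hn.
    rewrite Rminus_diag, Rabs_R0. apply Rmult_le_pos; [lra|exact HS].
Qed.

(** A component above [B] would carry more than [B ^ 2 / 2] of the energy
    [clamp_primitive], whose total does not increase and is at most [B ^ 2 / 2] at
    time 0.  So the clamp never acts, and the clamped system is the true one. *)
Lemma galerkin_solution (nu beta B : R) (x : nat -> R) (N : nat) :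
  0 < nu -> 0 < B -> (forall n, 0 <= x n) -> x 0%nat = 0 ->
  total (fun n => x n ^ 2) N <= B ^ 2 ->
  exists X : nat -> R -> R,
    flow nu beta N X /\ (forall n t, X n t <= B) /\
    (forall n t, (N < n)%nat -> X n t = 0) /\
    (forall n, (n <= N)%nat -> X n 0 = x n) /\
    (forall n t, (1 <= n <= N)%nat -> 0 <= t ->
       X n t = x n + RInt (fun s => clamped_field nu beta B (fun m => X m s) n) 0 t).
Proof.
  intros Hnu HB' Hx Hx0 HE. assert (HB : 0 <= B) by lra.
  set (F := galerkin_field nu beta B N).
  set (L := 1 + total (clamped_constant nu beta B) N).
  set (y := fun n => if (n <=? N)%nat then x n else 0).
  assert (HLip : forall n, local_lipschitz F n L)
    by (intros n; apply galerkin_field_lipschitz; assumption).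
  assert (HL : 0 < L).
  { unfold L. assert (0 <= total (clamped_constant nu beta B) N); [|lra].
    apply total_nonneg. intros m _. apply clamped_constant_nonneg; assumption. }
  assert (HA : forall n, Rabs (F y n) <= total (fun n => Rabs (F y n)) N).
  { intros n. destruct (classic (1 <= n <= N)%nat) as [Hn|Hn].
    - apply (term_le_total (fun n => Rabs (F y n))); [exact Hn|intros m _; apply Rabs_pos].
    - unfold F at 1. rewrite galerkin_field_outside by exact Hn. rewrite Rabs_R0.
      apply total_nonneg. intros m _. apply Rabs_pos. }
  destruct (picard_solution F y L _ HL HLip HA) as [X [Hc [Hmax Heq]]].
  assert (HFc : forall n t, continuous (fun s => F (fun m => X m s) n) t)
    by (intros n t; apply (local_lipschitz_continuous F n L); [apply HLip|exact Hc]).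
  assert (Hpos_time : forall (P : nat -> R -> Prop),
             (forall n t, 0 <= t -> P n (X n t)) -> forall n t, P n (X n t)).
  { intros P HP n t. rewrite Hmax. apply HP, Rmax_l. }
  assert (Hinit : forall n, X n 0 = y n).
  { intros n. rewrite Heq by lra. rewrite RInt_point. unfold zero; simpl. ring. }
  assert (Hout : forall n t, ~ (1 <= n <= N)%nat -> X n t = 0).
  { apply (Hpos_time (fun n r => ~ (1 <= n <= N)%nat -> r = 0)).
    intros n t Ht Hn. rewrite Heq by exact Ht.
    rewrite (RInt_ext _ (fun _ => 0))
      by (intros s _; apply galerkin_field_outside, Hn).
    rewrite RInt_const. unfold scal; simpl. unfold mult; simpl. rewrite Rmult_0_r, Rplus_0_r.
    unfold y. destruct (Nat.leb_spec n N); [|reflexivity].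
    replace n with 0%nat by lia. exact Hx0. }
  assert (Hder : forall n t, (1 <= n <= N)%nat -> 0 < t ->
            is_derive (X n) t (clamped_field nu beta B (fun m => X m t) n)).
  { intros n t Hn Ht. rewrite <- (galerkin_field_inside nu beta B N) by exact Hn.
    apply (integral_equation_derive (X n) (fun s => F (fun m => X m s) n) (y n));
      [apply HFc|apply Heq|exact Ht]. }
  assert (Hnn : forall n t, 0 <= X n t).
  { apply (Hpos_time (fun n r => 0 <= r)). intros n t Ht.
    destruct (classic (1 <= n <= N)%nat) as [Hn|Hn]; [|rewrite Hout by exact Hn; lra].
    apply (lower_barrier (X n) (fun r => clamped_field nu beta B (fun m => X m r) n)
             (- nu * lambda n ^ 2) 0 t Ht (Hc n)).
    - intros r Hr. apply Hder; [exact Hn|lra].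
    - intros r Hr Hneg. unfold clamped_field. rewrite (clamp_neg B (X n r)) by lra.
      assert (0 <= coef beta (n - 1) * clamp B (X (n - 1)%nat r) ^ 2)
        by (apply Rmult_le_pos; [apply coef_nonneg|apply pow2_ge_0]). lra.
    - rewrite Hinit. unfold y. destruct (n <=? N)%nat; [apply Hx|lra]. }
  assert (Hle : forall n t, X n t <= B).
  { apply (Hpos_time (fun n r => r <= B)). intros n t Ht.
    destruct (classic (1 <= n <= N)%nat) as [Hn|Hn]; [|rewrite Hout by exact Hn; lra].
    destruct (Rle_or_lt (X n t) B) as [H|H]; [exact H|exfalso].
    assert (Hmono : total (fun n => clamp_primitive B (X n t)) N
                    <= total (fun n => clamp_primitive B (X n 0)) N).
    { apply (nonincreasing (fun r => total (fun n => clamp_primitive B (X n r)) N)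
        (fun r => total (fun n => clamp B (X n r) *
                          clamped_field nu beta B (fun m => X m r) n) N)); [exact Ht| | |].
      - intros r. apply (total_continuous (fun n r => clamp_primitive B (X n r))).
        intros m. apply (continuous_comp (X m) (clamp_primitive B)); [apply Hc|].
        eapply derive_continuous, clamp_primitive_derive, HB.
      - intros r Hr. apply (total_derive (fun n r => clamp_primitive B (X n r))).
        intros m Hm. rewrite Rmult_comm.
        apply (is_derive_comp (clamp_primitive B) (X m)).
        + apply clamp_primitive_derive, HB.
        + apply Hder; [exact Hm|lra].
      - intros r Hr. apply (clamped_balance nu beta B (fun m => X m r)); assumption. }
    assert (Hprim : forall r, 0 <= r -> 0 <= clamp_primitive B r <= r ^ 2 / 2).
    { intros r Hr. unfold clamp_primitive. assert (Hcl := clamp_range B r HB).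
      destruct (Rle_or_lt r B) as [Hr'|Hr'].
      - rewrite clamp_id by lra. nra.
      - rewrite clamp_large by lra. nra. }
    assert (Hlow : clamp_primitive B (X n t) <= total (fun n => clamp_primitive B (X n t)) N).
    { apply (term_le_total (fun n => clamp_primitive B (X n t))); [exact Hn|].
      intros m _. apply Hprim, Hnn. }
    assert (Hup : total (fun n => clamp_primitive B (X n 0)) N
                  <= total (fun n => / 2 * (x n ^ 2)) N).
    { apply total_le. intros m Hm. rewrite Hinit. unfold y.
      rewrite (proj2 (Nat.leb_le m N)) by lia. assert (Hpm := Hprim (x m) (Hx m)). lra. }
    assert (Hscal : forall g M, total (fun n => / 2 * g n) M = / 2 * total g M).
    { intros g M. induction M as [|M IH]; simpl; [|rewrite IH]; ring. }
    rewrite Hscal in Hup.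
    unfold clamp_primitive in Hlow at 1. rewrite clamp_large in Hlow by lra. nra. }
  exists X. split; [split|].
  - exact Hc.
  - exact Hnn.
  - intros t. apply Hout. lia.
  - intros n t Hn Ht.
    replace (field nu beta (fun m => X m t) n)
      with (clamped_field nu beta B (fun m => X m t) n); [apply Hder; assumption|].
    unfold clamped_field, field. rewrite !clamp_id by (split; [apply Hnn|apply Hle]). reflexivity.
  - split; [exact Hle|]. split; [intros n t Hn; apply Hout; lia|]. split.
    + intros n Hn. rewrite Hinit. unfold y. rewrite (proj2 (Nat.leb_le n N)) by lia. reflexivity.
    + intros n t Hn Ht. rewrite Heq by exact Ht. unfold y at 1.
      rewrite (proj2 (Nat.leb_le n N)) by lia. f_equal. apply RInt_ext.
      intros s _. apply galerkin_field_inside, Hn.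
Qed.

(** * Existence *)

Lemma D_in_of_derive (f : R -> R) (df : R -> R) (D : R -> Prop) (t : R) :
  is_derive f t (df t) -> D_in f df D t.
Proof.
  intros H. apply is_derive_Reals in H. intros eps Heps.
  destruct (H eps Heps) as [d Hd].
  exists d. split; [apply cond_pos|]. intros r [[_ Hne] Hr]. simpl in *.
  unfold Rdist in *.
  specialize (Hd (r - t) ltac:(lra) Hr). replace (t + (r - t)) with r in Hd by ring. exact Hd.
Qed.

Lemma continue_in_of_continuous (f : R -> R) (D : R -> Prop) (t : R) :
  continuous f t -> continue_in f D t.
Proof.
  intros H eps Heps. destruct (continuous_eps f t H eps Heps) as [d [Hd Hn]].
  exists d. split; [exact Hd|]. intros r [_ Hr]. exact (Hn r Hr).
Qed.

(** Every approximation of order at least [K] obeys the first [K] equations, so it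
    is compared with the one of order [K]. *)
Lemma galerkin_close (nu beta B : R) (x : nat -> R) (X : nat -> nat -> R -> R) :
  0 < nu -> beta < 3 -> 0 <= B ->
  (forall N, total (fun n => x n ^ 2) N <= B ^ 2) ->
  (forall N, flow nu beta N (X N)) -> (forall N n t, X N n t <= B) ->
  (forall N n, (n <= N)%nat -> X N n 0 = x n) ->
  forall n eps, (1 <= n)%nat -> 0 < eps ->
  exists K, forall N, (K <= N)%nat -> forall t, 0 <= t -> Rabs (X N n t - X K n t) <= eps.
Proof.
  intros Hnu Hb HB HE HX HXB HX0 n eps Hn Heps.
  destruct (leak_vanishes nu beta (2 ^ n * (2 * B ^ 2 * B)) Hnu Hb (eps ^ 2) ltac:(nra))
    as [K0 HK0].
  set (K := max K0 n). exists K. intros N HN t Ht.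
  assert (HK := HK0 K ltac:(lia) ltac:(lia)).
  assert (Hsq : (X N n t - X K n t) ^ 2 <= 2 ^ n * (2 * B ^ 2 * B) * leak nu beta K).
  { apply (comparison_component nu beta B (B ^ 2) n K (X N) (X K) t); try assumption.
    - lia.
    - apply (flow_le _ _ _ _ _ HN (HX N)).
    - apply HX.
    - intros m Hm. rewrite !HX0 by lia. reflexivity.
    - apply Rle_trans with (total (fun n => x n ^ 2) K); [|apply HE].
      apply total_le. intros m Hm. rewrite HX0 by lia. lra.
    - intros r _. apply HXB.
    - intros r _. apply HXB. }
  apply Rabs_le_between. nra.
Qed.

Lemma existence (nu beta B : R) (x : nat -> R) :
  0 < nu -> beta < 3 -> 0 < B -> (forall n, (1 <= n)%nat -> 0 <= x n) ->
  (forall N, total (fun n => x n ^ 2) N <= B ^ 2) ->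
  exists X, weak_solution nu beta x X.
Proof.
  intros Hnu Hb HB' Hx HE. assert (HB : 0 <= B) by lra.
  set (y := fun n => match n with O => 0 | S _ => x n end).
  assert (HEy : forall N, total (fun n => y n ^ 2) N <= B ^ 2).
  { intros N. replace (total (fun n => y n ^ 2) N) with (total (fun n => x n ^ 2) N);
      [apply HE|]. apply total_ext. intros [|n] Hn; [lia|reflexivity]. }
  destruct (functional_choice _ (fun N => galerkin_solution nu beta B y N Hnu HB'
     ltac:(intros [|n]; [simpl; lra|apply Hx; lia]) eq_refl (HEy N))) as [X HX].
  assert (Hlim : forall n, exists v, (forall t, continuous v t) /\
            (forall t, v t = v (Rmax 0 t)) /\ converges_uniformly (fun N => X N n) v).
  { intros n. apply uniform_limit.
    - intros N. apply (flow_continuous _ _ _ _ (proj1 (HX N))).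
    - intros T eps Heps. destruct n as [|n].
      + exists O. intros k _ t _.
        rewrite !(flow_zero _ _ _ _ (proj1 (HX _))), Rminus_diag, Rabs_R0. lra.
      + destruct (galerkin_close nu beta B y X Hnu Hb HB HEy) with (n := S n) (eps := eps)
          as [K HK]; try assumption; try lia.
        * intros N. apply HX.
        * intros N. apply HX.
        * intros N. apply HX.
        * exists K. intros k Hk t Ht. apply HK; [exact Hk|lra]. }
  destruct (functional_choice _ Hlim) as [v Hv].
  set (F := clamped_field nu beta B).
  assert (HFc : forall n t, continuous (fun s => F (fun m => v m s) n) t).
  { intros n t. eapply local_lipschitz_continuous; [apply clamped_field_lipschitz; assumption|].
    intros m. apply (Hv m). }
  assert (Hrange : forall n t, 0 <= t -> 0 <= v n t <= B).
  { intros n t Ht.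
    assert (Hl := converges_uniformly_at _ _ t (proj2 (proj2 (Hv n))) Ht).
    split.
    - apply (is_lim_seq_le (fun _ => 0) (fun N => X N n t) 0 (v n t));
        [|apply is_lim_seq_const|exact Hl].
      intros N. apply (flow_nonneg _ _ _ _ (proj1 (HX N))).
    - apply (is_lim_seq_le (fun N => X N n t) (fun _ => B) (v n t) B);
        [|exact Hl|apply is_lim_seq_const].
      intros N. apply (HX N). }
  assert (Hzero : forall t, 0 <= t -> v 0%nat t = 0).
  { intros t Ht.
    assert (Hl := converges_uniformly_at _ _ t (proj2 (proj2 (Hv O))) Ht).
    assert (Hl0 : is_lim_seq (fun N => X N 0%nat t) 0).
    { apply (is_lim_seq_ext (fun _ => 0)); [|apply is_lim_seq_const].
      intros N. symmetry. apply (flow_zero _ _ _ _ (proj1 (HX N))). }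
    apply is_lim_seq_unique in Hl. apply is_lim_seq_unique in Hl0.
    rewrite Hl in Hl0. injection Hl0. auto. }
  assert (Heq : forall n, (1 <= n)%nat -> forall t, 0 <= t ->
            v n t = y n + RInt (fun s => F (fun m => v m s) n) 0 t).
  { intros n Hn.
    apply (integral_equation_limit (fun N => X N n) (fun N s => F (fun m => X N m s) n)).
    - intros N t. eapply local_lipschitz_continuous; [apply clamped_field_lipschitz; assumption|].
      intros m. apply (flow_continuous _ _ _ _ (proj1 (HX N))).
    - apply HFc.
    - apply (Hv n).
    - eapply (local_lipschitz_converges F n _ X v);
        [apply clamped_field_lipschitz; assumption|intros m; apply (Hv m)].
    - exists n. intros N HN t Ht. apply (HX N); [lia|exact Ht]. }
  set (Y := fun n t => match n with
            | O => 0 | S _ => y n + RInt (fun s => F (fun m => v m s) n) 0 t end).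
  assert (HY : forall n t, 0 <= t -> Y n t = v n t).
  { intros [|n] t Ht; simpl; [symmetry; apply Hzero, Ht|].
    symmetry. apply Heq; [lia|exact Ht]. }
  exists Y. intros n Hn. split.
  - destruct n as [|n]; [lia|]. simpl. rewrite RInt_point. unfold zero; simpl. ring.
  - exists (fun s => F (fun m => v m s) n). split.
    + intros t Ht. split; [|apply continue_in_of_continuous, HFc].
      apply D_in_of_derive. destruct n as [|n]; [lia|].
      apply (primitive_derive (fun s => F (fun m => v m s) (S n))), HFc.
    + intros t Ht. rewrite !HY by exact Ht. unfold F, clamped_field.
      rewrite !clamp_id by (apply Hrange, Ht). reflexivity.
Qed.

(** * The invariant region *)

(** The hint is [x^6 >= 3 s^2 x^2 - 2 s^3] with [s = 9/10], near the square of the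
    minimum point of the right-hand side. *)
Lemma lower_polynomial (x : R) : 0 <= x <= 1 ->
  0 <= 3 * (1 - 3/5 * x^2 - 39/125 * x^6)
       - 13/25 * (101/25) * x * (1 + x/100 - 101/100 * x^5).
Proof.
  intros [H0 H1].
  assert (H : 0 <= (x^2 - 9/10)^2 * (x^2 + 9/5)).
  { apply Rmult_le_pos; [apply pow2_ge_0|nra]. }
  nra.
Qed.

(** The transfer part of the vector field points inwards at a point [(x, y)] of the
    lower curve [y = h x], with [h x = q (101/100 x^4 - 1/100)].  The two sides are
    the speed of [h x] and that of [y]; [w] and [z] are the outer neighbours.
    At [x = w = 1], where [y = q], the speed of [x] vanishes while [z] is below
    1 because of the upper line, so that [y] grows. *)
Lemma lower_face (q c w x y z : R) :
  1/2 <= q <= 13/25 -> 3 <= c -> 0 <= w <= 1 -> 0 <= x <= 1 -> 0 <= y ->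
  y = q * (101/100 * x^4 - 1/100) -> z <= 3/5 + 3/5 * y ->
  q * (101/25) * x^3 * (q * w^2 - x * y) <= c * (q * x^2 - y * z).
Proof.
  intros Hq Hc Hw Hx Hy Ey Hz.
  assert (Hx4 : 0 <= x^4 <= 1).
  { split; [apply pow_le; lra|]. rewrite <- (pow1 4). apply pow_incr; lra. }
  assert (Hx5 : 0 <= x^5 <= 1).
  { split; [apply pow_le; lra|]. rewrite <- (pow1 5). apply pow_incr; lra. }
  assert (Hx6 : 0 <= x^6 <= 1).
  { split; [apply pow_le; lra|]. rewrite <- (pow1 6). apply pow_incr; lra. }
  assert (Hx2 : 0 <= x^2 <= 1) by nra.
  assert (Hx3 : 0 <= x^3) by (apply pow_le; lra).
  set (A := 1 - 3/5 * x^2 - 39/125 * x^6).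
  set (B := 1 + x/100 - 101/100 * x^5).
  assert (HA : 0 <= A) by (unfold A; lra).
  assert (HB : 0 <= B) by (unfold B; nra).
  assert (Hyq : y <= q * x^4) by nra.
  assert (Hyz : q * x^2 * A <= q * x^2 - y * z).
  { assert (y * z <= y * (3/5 + 3/5 * y)) by nra.
    assert (y * (3/5 + 3/5 * y) <= q * x^4 * (3/5 + 3/5 * (13/25 * x^4))).
    { apply Rmult_le_compat; nra. }
    unfold A. nra. }
  assert (Hw2 : w^2 <= 1) by nra.
  assert (Hl : q * w^2 - x * y <= 13/25 * B).
  { assert (q * w^2 - x * y <= q * B) by (unfold B; rewrite Ey; nra). nra. }
  assert (HP : 13/25 * (101/25) * x * B <= 3 * A).
  { assert (H := lower_polynomial x Hx). unfold A, B. lra. }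
  apply Rle_trans with (q * x^2 * (3 * A)).
  - apply Rle_trans with (q * x^2 * (13/25 * (101/25) * x * B)).
    + replace (q * x^2 * (13/25 * (101/25) * x * B))
        with (q * (101/25) * x^3 * (13/25 * B)) by ring.
      apply Rmult_le_compat_l; [|exact Hl].
      apply Rmult_le_pos; [lra|exact Hx3].
    + apply Rmult_le_compat_l; [|exact HP]. apply Rmult_le_pos; lra.
  - replace (q * x^2 * (3 * A)) with (3 * (q * x^2 * A)) by ring.
    assert (0 <= q * x^2 * A) by (repeat apply Rmult_le_pos; lra). nra.
Qed.

(** For [y] above 3/5 the lower curve gives [y * z] enough room over [x^2].  The proof
    replaces [y^5] by its Taylor parabolas at 3/5 and at 7/10, each of which lies below
    [y^5] to the right of its own point. *)
Lemma upper_polynomial (y : R) : 3/5 <= y <= 1 ->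
  3/5 * (5/3 * y - 1) * y
    <= 3/2 * (y * (101/100 * y^4 - 1/100) - (5/3 * y - 1)^2).
Proof.
  intros Hy.
  assert (Ht : forall t, 0 <= t <= y -> 10 * t^3 * y^2 - 15 * t^4 * y + 6 * t^5 <= y^5).
  { intros t Ht.
    assert (0 <= (y - t)^3 * (y^2 + 3 * t * y + 6 * t^2)).
    { apply Rmult_le_pos; [apply pow_le; lra|nra]. }
    nra. }
  destruct (Rlt_or_le y (7/10)).
  - assert (H1 := Ht (3/5) ltac:(lra)). nra.
  - assert (H1 := Ht (7/10) ltac:(lra)). nra.
Qed.

(** The transfer part points inwards along the upper line [y = 3/5 + 3/5 x] too,
    since there the lower curve makes [z] large enough for [y] to decrease. *)
Lemma upper_face (q c w x y z : R) :
  1/2 <= q -> 3 <= c -> 0 <= x -> 0 <= y <= 1 ->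
  y = 3/5 + 3/5 * x -> q * (101/100 * y^4 - 1/100) <= z ->
  c * (q * x^2 - y * z) <= 3/5 * (q * w^2 - x * y).
Proof.
  intros Hq Hc Hx Hy Ey Hz.
  assert (Hp := upper_polynomial y ltac:(lra)).
  replace (5/3 * y - 1) with x in Hp by lra.
  set (D := y * (101/100 * y^4 - 1/100) - x^2) in *.
  assert (HD : 0 <= D) by nra.
  assert (H1 : q * D <= y * z - q * x^2).
  { unfold D. nra. }
  assert (H2 : 3 * (1/2 * D) <= c * (y * z - q * x^2)).
  { apply Rmult_le_compat; nra. }
  assert (0 <= q * w^2) by (apply Rmult_le_pos; [lra|apply pow2_ge_0]).
  lra.
Qed.

(** All the pairs [(Y n, Y (n+1))] with [1 <= n <= N] stay in the region
    [q (101/100 x^4 - 1/100) < y < 3/5 + 3/5 x], [x < 1].  Its three faces are guarded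
    as follows.
    - On [x = 1] the lower curve gives [y >= q], so that the outgoing transfer
      balances the incoming one.
    - On the two curves, [lower_face] and [upper_face] handle the transfers.
    - The viscosity acts as [(-x, -4 y)], up to a positive factor.  It points
      inwards along the curves because the logarithmic slope is at most 4
      on the upper line, and at least 4 on the lower curve: hence the power 4.
    Beyond [N] the viscosity is stronger than the transfer and the components stay
    below 3/10, where the lower curve is negative.  So the constraints on the shells
    up to [N + 2] form a finite family that is closed under its own dynamics, which
    is what [first_exit] requires; the shells further out follow by induction. *)
Lemma normalized_region (nu q c s : R) (K : nat -> R) (N : nat) (Y : nat -> R -> R) :
  0 < nu -> 1 / 2 <= q <= 13 / 25 -> 3 <= c ->
  (forall n, 0 < K n) -> (forall n, K (S n) = c * K n) ->
  (forall n, (N < n)%nat -> q * K n < 3 / 10 * (nu * lambda n ^ 2)) ->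
  (forall n t, continuous (Y n) t) -> (forall n t, 0 <= Y n t) ->
  (forall t, Y 0%nat t = 0) ->
  (forall n t, s < t ->
     is_derive (Y (S n)) t (- nu * lambda (S n) ^ 2 * Y (S n) t
       + K (S n) * (q * Y n t ^ 2 - Y (S n) t * Y (S (S n)) t))) ->
  (forall n, Y n s < 3 / 10) ->
  forall n t, s <= t -> Y n t <= 1.
Proof.
  intros Hnu Hq Hc HK0 HKS HN HYc HY0 HYz HYd Hs.
  set (U := fun n : nat => if (n <=? N)%nat then 1 else 3 / 10).
  assert (HU1 : forall n, (n <= N)%nat -> U n = 1).
  { intros n Hn. unfold U. rewrite (proj2 (Nat.leb_le n N)) by exact Hn. reflexivity. }
  assert (HU2 : forall n, (N < n)%nat -> U n = 3 / 10).
  { intros n Hn. unfold U. destruct (Nat.leb_spec n N); [lia|reflexivity]. }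
  assert (HU : forall n, 3 / 10 <= U n <= 1).
  { intros n. unfold U. destruct (n <=? N)%nat; lra. }
  set (top := fun n t => U n - Y n t).
  set (low := fun n t => Y (S n) t - q * (101 / 100 * Y n t ^ 4 - 1 / 100)).
  set (upp := fun n t => 3 / 5 + 3 / 5 * Y n t - Y (S n) t).
  set (l := map top (seq 1 (N + 2)) ++ map low (seq 1 N) ++ map upp (seq 1 N)).
  assert (Hin : forall (P : (R -> R) -> Prop),
     (forall n, (1 <= n <= N + 2)%nat -> P (top n)) ->
     (forall n, (1 <= n <= N)%nat -> P (low n)) ->
     (forall n, (1 <= n <= N)%nat -> P (upp n)) -> forall f, In f l -> P f).
  { intros P H1 H2 H3 f Hf. unfold l in Hf.
    apply in_app_or in Hf. destruct Hf as [Hf|Hf]; [|apply in_app_or in Hf; destruct Hf as [Hf|Hf]];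
      apply in_map_iff in Hf; destruct Hf as [n [<- Hn]]; apply in_seq in Hn;
      [apply H1|apply H2|apply H3]; lia. }
  assert (Htop : forall n, (1 <= n <= N + 2)%nat -> In (top n) l).
  { intros n Hn. apply in_or_app. left. apply in_map. apply in_seq. lia. }
  assert (Hlow : forall n, (1 <= n <= N)%nat -> In (low n) l).
  { intros n Hn. apply in_or_app. right. apply in_or_app. left. apply in_map, in_seq. lia. }
  assert (Hupp : forall n, (1 <= n <= N)%nat -> In (upp n) l).
  { intros n Hn. apply in_or_app. right. apply in_or_app. right. apply in_map, in_seq. lia. }
  assert (Hexit : forall f t, In f l -> s <= t -> 0 < f t).
  { apply first_exit.
    - intros f t Hf. revert f Hf. apply Hin; intros n Hn; unfold top, low, upp;
        assert (Ha := HYc n); assert (Hb := HYc (S n)); continuity.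
    - apply Hin; intros n Hn; unfold top, low, upp.
      + assert (H := HU n). assert (H1 := Hs n). lra.
      + assert (H1 := Hs n). assert (H2 := HY0 n s). assert (H3 := HY0 (S n) s).
        assert (Y n s ^ 4 <= (3 / 10) ^ 4) by (apply pow_incr; lra). nra.
      + assert (H1 := Hs (S n)). assert (H2 := HY0 n s). lra.
    - intros f t Hf Ht. revert f Hf.
      apply (Hin (fun f => f t = 0 -> (forall g, In g l -> 0 <= g t) ->
                   exists d, is_derive f t d /\ 0 < d)).
      + (* The ceiling [Y n = U n]: up to shell [N] the lower curve makes the
           outgoing transfer sufficient, beyond it the viscosity is. *)
        intros n Hn Hz Hall. destruct n as [|n]; [lia|].
        assert (Hd := HYd n t Ht).
        assert (Hl := lambda_sq_pos (S n) ltac:(lia)).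
        assert (Hw : 0 <= Y n t <= 1).
        { split; [apply HY0|]. destruct n as [|n]; [rewrite HYz; lra|].
          assert (H := Hall _ (Htop (S n) ltac:(lia))). unfold top in H.
          assert (H1 := HU (S n)). lra. }
        eexists. split; [unfold top; derivative|].
        unfold top in Hz. assert (HKn := HK0 (S n)).
        assert (Hw2 : Y n t ^ 2 <= 1) by nra.
        assert (Hz0 := HY0 (S (S n)) t).
        destruct (Nat.le_gt_cases (S n) N) as [HnN|HnN].
        * rewrite HU1 in Hz by exact HnN.
          assert (H := Hall _ (Hlow (S n) ltac:(lia))). unfold low in H.
          replace (Y (S n) t) with 1 in * by lra.
          assert (0 <= K (S n) * (Y (S (S n)) t - q * Y n t ^ 2))
            by (apply Rmult_le_pos; [lra|nra]).
          nra.
        * rewrite HU2 in Hz by exact HnN.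
          replace (Y (S n) t) with (3 / 10) in * by lra.
          assert (Hvis := HN (S n) HnN).
          assert (K (S n) * (q * Y n t ^ 2) <= K (S n) * q)
            by (apply Rmult_le_compat_l; [lra|nra]).
          assert (0 <= K (S n) * (3 / 10 * Y (S (S n)) t))
            by (apply Rmult_le_pos; lra).
          lra.
      + (* The lower curve: the viscous part is strictly inward because of the
           constant 1/100, the transfer part by [lower_face]. *)
        intros n Hn Hz Hall. destruct n as [|n]; [lia|].
        assert (Hd := HYd n t Ht). assert (Hd' := HYd (S n) t Ht).
        assert (Hl := lambda_sq_pos (S n) ltac:(lia)).
        assert (Hl4 : lambda (S (S n)) ^ 2 = 4 * lambda (S n) ^ 2)
          by (unfold lambda; simpl; ring).
        rewrite Hl4, HKS in Hd'.
        assert (Hw : 0 <= Y n t <= 1).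
        { split; [apply HY0|]. destruct n as [|n]; [rewrite HYz; lra|].
          assert (H := Hall _ (Htop (S n) ltac:(lia))). unfold top in H.
          assert (H1 := HU (S n)). lra. }
        assert (Hx : 0 <= Y (S n) t <= 1).
        { split; [apply HY0|].
          assert (H := Hall _ (Htop (S n) ltac:(lia))). unfold top in H.
          assert (H1 := HU (S n)). lra. }
        assert (Hy := HY0 (S (S n)) t).
        assert (HZ : Y (S (S (S n))) t <= 3 / 5 + 3 / 5 * Y (S (S n)) t).
        { destruct (Nat.le_gt_cases (S (S n)) N) as [HnN|HnN].
          - assert (H := Hall _ (Hupp (S (S n)) ltac:(lia))). unfold upp in H. lra.
          - assert (H := Hall _ (Htop (S (S (S n))) ltac:(lia))). unfold top in H.
            rewrite HU2 in H by lia. lra. }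
        unfold low in Hz.
        assert (Ey : Y (S (S n)) t = q * (101 / 100 * Y (S n) t ^ 4 - 1 / 100)) by lra.
        assert (Hface := lower_face q c (Y n t) (Y (S n) t) (Y (S (S n)) t)
                           (Y (S (S (S n))) t) Hq Hc Hw Hx Hy Ey HZ).
        eexists. split; [unfold low; derivative|]. cbv beta.
        assert (HKn := HK0 (S n)).
        set (k := K (S n)) in *. set (v := nu * lambda (S n) ^ 2).
        assert (Hv : 0 < v) by (apply Rmult_lt_0_compat; lra).
        set (x := Y (S n) t) in *. set (y := Y (S (S n)) t) in *.
        set (w := Y n t) in *. set (z := Y (S (S (S n))) t) in *.
        match goal with |- 0 < ?e => replace e with
          (4 * v * (q * (101 / 100) * x ^ 4 - y)
           + k * (c * (q * x ^ 2 - y * z) - q * (101 / 25) * x ^ 3 * (q * w ^ 2 - x * y)))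
          by (unfold v; field) end.
        assert (0 < 4 * v * (q * (101 / 100) * x ^ 4 - y)).
        { apply Rmult_lt_0_compat; lra. }
        assert (0 <= k * (c * (q * x ^ 2 - y * z) - q * (101 / 25) * x ^ 3 * (q * w ^ 2 - x * y)))
          by (apply Rmult_le_pos; lra).
        lra.
      + (* The upper line, which is out of reach for [n = N] since the next
           component is below 3/10 there. *)
        intros n Hn Hz Hall. destruct n as [|n]; [lia|].
        assert (Hd := HYd n t Ht). assert (Hd' := HYd (S n) t Ht).
        assert (Hl := lambda_sq_pos (S n) ltac:(lia)).
        assert (Hl4 : lambda (S (S n)) ^ 2 = 4 * lambda (S n) ^ 2)
          by (unfold lambda; simpl; ring).
        rewrite Hl4, HKS in Hd'.
        assert (Hx := HY0 (S n) t).
        unfold upp in Hz.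
        assert (Hy := Hall _ (Htop (S (S n)) ltac:(lia))). unfold top in Hy.
        assert (HnN : (S (S n) <= N)%nat).
        { destruct (Nat.le_gt_cases (S (S n)) N) as [HnN|HnN]; [exact HnN|exfalso].
          rewrite HU2 in Hy by lia. lra. }
        rewrite HU1 in Hy by exact HnN.
        assert (HZ := Hall _ (Hlow (S (S n)) ltac:(lia))). unfold low in HZ.
        assert (Hface := upper_face q c (Y n t) (Y (S n) t) (Y (S (S n)) t)
                  (Y (S (S (S n))) t) ltac:(lra) Hc Hx ltac:(split; [apply HY0|lra])
                  ltac:(lra) ltac:(lra)).
        eexists. split; [unfold upp; derivative|]. cbv beta.
        assert (HKn := HK0 (S n)).
        set (k := K (S n)) in *. set (v := nu * lambda (S n) ^ 2).
        assert (Hv : 0 < v) by (apply Rmult_lt_0_compat; lra).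
        set (x := Y (S n) t) in *. set (y := Y (S (S n)) t) in *.
        set (w := Y n t) in *. set (z := Y (S (S (S n))) t) in *.
        match goal with |- 0 < ?e => replace e with
          (v * (4 * y - 3 / 5 * x)
           + k * (3 / 5 * (q * w ^ 2 - x * y) - c * (q * x ^ 2 - y * z)))
          by (unfold v; field) end.
        assert (0 < v * (4 * y - 3 / 5 * x)) by (apply Rmult_lt_0_compat; lra).
        assert (0 <= k * (3 / 5 * (q * w ^ 2 - x * y) - c * (q * x ^ 2 - y * z)))
          by (apply Rmult_le_pos; lra).
        lra. }
  assert (Hsmall : forall n t, (n <= N + 2)%nat -> s <= t -> Y n t <= 1).
  { intros n t Hn Ht. destruct n as [|n]; [rewrite HYz; lra|].
    assert (H := Hexit _ t (Htop (S n) ltac:(lia)) Ht). unfold top in H.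
    assert (H1 := HU (S n)). lra. }
  intros n. induction n as [|n IH]; intros t Ht; [rewrite HYz; lra|].
  destruct (Nat.le_gt_cases (S n) (N + 2)) as [Hn|Hn]; [apply Hsmall; assumption|].
  assert (0 <= 3 / 10 - Y (S n) t); [|lra].
  apply (lower_barrier (fun t => 3 / 10 - Y (S n) t)
     (fun t => 0 - (- nu * lambda (S n) ^ 2 * Y (S n) t
       + K (S n) * (q * Y n t ^ 2 - Y (S n) t * Y (S (S n)) t))) 0 s t Ht).
  - intros r. assert (H := HYc (S n)). continuity.
  - intros r Hr. apply is_derive_Rminus; [apply is_derive_Rconst|]. apply HYd. lra.
  - intros r Hr Hneg.
    assert (Hw := IH r ltac:(lra)). assert (Hw0 := HY0 n r).
    assert (Hz0 := HY0 (S (S n)) r). assert (HKn := HK0 (S n)).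
    assert (Hl := lambda_sq_pos (S n) ltac:(lia)). assert (Hvis := HN (S n) ltac:(lia)).
    assert (Hw2 : Y n r ^ 2 <= 1) by nra.
    assert (K (S n) * (q * Y n r ^ 2) <= K (S n) * q)
      by (apply Rmult_le_compat_l; [lra|nra]).
    assert (0 <= K (S n) * (Y (S n) r * Y (S (S n)) r))
      by (apply Rmult_le_pos; [lra|apply Rmult_le_pos; [apply HY0|exact Hz0]]).
    assert (nu * lambda (S n) ^ 2 * (3 / 10) <= nu * lambda (S n) ^ 2 * Y (S n) r).
    { apply Rmult_le_compat_l; [apply Rmult_le_pos; lra|lra]. }
    lra.
  - assert (H := Hs (S n)). lra.
Qed.

(** * Weak solutions as trajectories *)

(** Freezing the trajectory at negative times gives functions that are continuous
    on the whole line. *)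
Definition half_line (X : nat -> R -> R) (n : nat) (t : R) : R :=
  match n with O => 0 | S _ => X n (Rmax 0 t) end.

Lemma half_line_eq (X : nat -> R -> R) (n : nat) (t : R) :
  (1 <= n)%nat -> 0 <= t -> half_line X n t = X n t.
Proof. intros Hn Ht. destruct n; [lia|]. simpl. rewrite Rmax_right by exact Ht. reflexivity. Qed.

Lemma half_line_continuous (f df : R -> R) (t : R) :
  (forall t, 0 <= t -> D_in f df nonneg_time t) -> continuous (fun t => f (Rmax 0 t)) t.
Proof.
  intros Hf. apply continuous_of_eps. intros eps Heps.
  assert (H := cont_deriv f df nonneg_time (Rmax 0 t) (Hf _ (Rmax_l 0 t))).
  destruct (H eps Heps) as [d [Hd Hn]]. exists d. split; [exact Hd|].
  intros y Hy. destruct (Req_dec (Rmax 0 y) (Rmax 0 t)) as [->|Hne].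
  - rewrite Rminus_diag, Rabs_R0. exact Heps.
  - apply (Hn (Rmax 0 y)). split.
    + split; [apply Rmax_l|]. intros E. apply Hne. symmetry. exact E.
    + eapply Rle_lt_trans; [apply Rmax_lipschitz|exact Hy].
Qed.

Lemma half_line_derive (f df : R -> R) (t : R) :
  0 < t -> D_in f df nonneg_time t -> is_derive (fun t => f (Rmax 0 t)) t (df t).
Proof.
  intros Ht H. apply is_derive_Reals. intros eps Heps.
  destruct (H eps Heps) as [d [Hd Hn]].
  exists (mkposreal (Rmin d t) (Rmin_pos _ _ Hd Ht)). intros h Hh Hhd. simpl in Hhd.
  assert (Hm1 := Rmin_l d t). assert (Hm2 := Rmin_r d t).
  assert (Hh2 := Rabs_def2 h t ltac:(lra)).
  rewrite !Rmax_right by lra.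
  specialize (Hn (t + h)). simpl in Hn. unfold Rdist in Hn.
  replace (t + h - t) with h in Hn by ring.
  apply Hn. split; [|lra]. split; [unfold nonneg_time; lra|lra].
Qed.

(** Positivity: each component solves a linear equation with a non-negative
    source term and a coefficient that is bounded on bounded time intervals. *)
Lemma weak_solution_flow (nu beta : R) (x : nat -> R) (X : nat -> R -> R) (N : nat) :
  (forall n, (1 <= n)%nat -> 0 <= x n) -> weak_solution nu beta x X ->
  flow nu beta N (half_line X).
Proof.
  intros Hx HX.
  assert (Hc : forall n t, continuous (half_line X n) t).
  { intros [|n] t; [apply continuous_const|].
    destruct (HX (S n) ltac:(lia)) as [_ [dX [HdX _]]].
    apply (half_line_continuous (X (S n)) dX). intros r Hr. apply HdX, Hr. }
  assert (Hd : forall n t, (1 <= n)%nat -> 0 < t ->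
            is_derive (half_line X n) t (field nu beta (fun m => half_line X m t) n)).
  { intros n t Hn Ht. destruct (HX n Hn) as [_ [dX [HdX HeqX]]].
    replace (field nu beta (fun m => half_line X m t) n) with (dX t).
    - destruct n as [|n]; [lia|].
      apply (half_line_derive (X (S n)) dX t Ht). apply HdX. lra.
    - rewrite HeqX by lra. unfold field.
      rewrite (half_line_eq X n), (half_line_eq X (n + 1)) by (lia || lra).
      fold (coef beta (n - 1)). fold (coef beta n).
      destruct n as [|[|n]]; [lia| |].
      + simpl Nat.sub. rewrite coef_0. ring.
      + rewrite half_line_eq by (lia || lra). reflexivity. }
  split; [exact Hc| |reflexivity|intros n t [Hn _] Ht; apply Hd; assumption].
  intros n t. destruct n as [|n]; [simpl; lra|].
  assert (Hpos : forall T, 0 <= T -> 0 <= half_line X (S n) T).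
  { intros T HT.
    set (A := fun r => - nu * lambda (S n) ^ 2 - coef beta (S n) * half_line X (S (S n)) r).
    destruct (continuity_ab_maj A 0 T HT) as [m [Hm _]].
    { intros r _. apply continuity_pt_filterlim.
      assert (H := Hc (S (S n))).
      assert (HcA : continuous A r) by (unfold A; continuity). exact HcA. }
    apply (lower_barrier (half_line X (S n))
             (fun r => field nu beta (fun m => half_line X m r) (S n)) (A m) 0 T HT (Hc (S n))).
    - intros r Hr. apply Hd; [lia|lra].
    - intros r Hr Hneg. rewrite field_S.
      assert (HA := Hm r ltac:(lra)).
      assert (H1 : A m * half_line X (S n) r <= A r * half_line X (S n) r) by nra.
      assert (H2 : 0 <= coef beta n * half_line X n r ^ 2)
        by (apply Rmult_le_pos; [apply coef_nonneg|apply pow2_ge_0]).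
      unfold A in H1 at 2. lra.
    - rewrite half_line_eq by (lia || lra). rewrite (proj1 (HX (S n) ltac:(lia))).
      apply Hx. lia. }
  change (half_line X (S n) t) with (X (S n) (Rmax 0 t)).
  assert (H := Hpos (Rmax 0 t) (Rmax_l 0 t)).
  rewrite half_line_eq in H by (lia || apply Rmax_l). exact H.
Qed.

Lemma flow_bound (nu beta E : R) (X : nat -> R -> R) :
  0 < nu -> (forall N, flow nu beta N X) -> (forall N, energy X N 0 <= E) ->
  forall n t, 0 <= t -> X n t <= E + 1.
Proof.
  intros Hnu HX HE n t Ht.
  assert (H1 := energy_nonincreasing nu beta X n 0 t Hnu (HX n) ltac:(lra)).
  assert (H2 := HE n).
  assert (H3 : X n t ^ 2 <= E).
  { destruct n as [|n].
    - rewrite (flow_zero _ _ _ _ (HX O)). apply Rle_trans with (energy X 0 0); [|apply HE].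
      unfold energy. simpl. lra.
    - apply Rle_trans with (energy X (S n) t); [|lra].
      apply (term_le_total (fun n => X n t ^ 2)); [lia|]. intros m _. apply pow2_ge_0. }
  nra.
Qed.

(** * Uniqueness *)

Lemma flow_unique (nu beta E : R) (X Y : nat -> R -> R) :
  0 < nu -> beta < 3 -> (forall N, flow nu beta N X) -> (forall N, flow nu beta N Y) ->
  (forall n, (1 <= n)%nat -> X n 0 = Y n 0) -> (forall N, energy X N 0 <= E) ->
  forall n t, (1 <= n)%nat -> 0 <= t -> X n t = Y n t.
Proof.
  intros Hnu Hb HX HY H0 HE n t Hn Ht.
  assert (HEY : forall N, energy Y N 0 <= E).
  { intros N. replace (energy Y N 0) with (energy X N 0); [apply HE|].
    apply total_ext. intros m Hm. cbv beta. rewrite H0 by lia. reflexivity. }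
  assert (HE0 : 0 <= E) by (apply Rle_trans with (energy X 0 0); [unfold energy; simpl; lra|apply HE]).
  assert (Hsq : (X n t - Y n t) ^ 2 <= 0).
  { apply le_epsilon. intros eps Heps. rewrite Rplus_0_l.
    destruct (leak_vanishes nu beta (2 ^ n * (2 * E * (E + 1))) Hnu Hb eps Heps) as [N0 HN0].
    set (N := max N0 n). specialize (HN0 N ltac:(lia) ltac:(lia)).
    eapply Rle_trans; [|apply Rlt_le, HN0].
    apply (comparison_component nu beta (E + 1) E n N X Y t Hnu); auto; try lra; try lia.
    - intros m Hm. apply H0. lia.
    - apply (flow_bound nu beta E X Hnu HX HE).
    - apply (flow_bound nu beta E Y Hnu HY HEY). }
  nra.
Qed.

(** * Smoothness *)

(** The sets of times where the partial enstrophies stay below a given level are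
    compact and nested, and by the energy estimate none of them is empty. *)
Lemma finite_enstrophy_time (nu beta E s t : R) (X : nat -> R -> R) :
  0 < nu -> (forall N, flow nu beta N X) -> (forall N, energy X N 0 <= E) ->
  0 <= s < t ->
  exists r M, s <= r <= t /\ 0 < M /\ forall N, enstrophy X N r <= M.
Proof.
  intros Hnu HX HE Hst.
  assert (HE0 : 0 <= E) by (apply Rle_trans with (energy X 0 0); [unfold energy; simpl; lra|apply HE]).
  assert (Hden : 0 < 2 * nu * (t - s)) by (apply Rmult_lt_0_compat; lra).
  set (M := (E + 1) / (2 * nu * (t - s))).
  assert (HM : 0 < M) by (apply Rdiv_lt_0_compat; lra).
  assert (HMe : 2 * nu * M * (t - s) = E + 1) by (unfold M; field; lra).
  assert (Hex : forall N, exists r, s <= r <= t /\ enstrophy X N r <= M).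
  { intros N. destruct (classic (exists r, s <= r <= t /\ enstrophy X N r <= M)) as [H|H];
      [exact H|exfalso].
    assert (Hd : energy X N t + 2 * nu * M * (t - s) <= energy X N s).
    { apply (energy_dissipation nu beta X N s t M Hnu (HX N)); [lra|].
      intros r Hr. destruct (Rle_or_lt (enstrophy X N r) M) as [Hle|Hlt]; [|lra].
      exfalso. apply H. exists r. split; [lra|exact Hle]. }
    assert (H1 := energy_nonincreasing nu beta X N 0 s Hnu (HX N) ltac:(lra)).
    assert (H2 := HE N).
    assert (H3 : 0 <= energy X N t) by (apply total_nonneg; intros n _; apply pow2_ge_0).
    lra. }
  destruct (functional_choice _ Hex) as [r Hr].
  destruct (Bolzano_Weierstrass r (fun c => s <= c <= t) (compact_P3 s t)
              (fun n => proj1 (Hr n))) as [l Hl].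
  assert (Hcl : s <= l <= t).
  { split; apply Rnot_lt_le; intros Hlt.
    - destruct (Hl (disc l (mkposreal (s - l) ltac:(lra))) O) as [p [_ Hp]].
      { exists (mkposreal (s - l) ltac:(lra)). intros y Hy. exact Hy. }
      unfold disc in Hp. simpl in Hp. apply Rabs_def2 in Hp. assert (H := Hr p). lra.
    - destruct (Hl (disc l (mkposreal (l - t) ltac:(lra))) O) as [p [_ Hp]].
      { exists (mkposreal (l - t) ltac:(lra)). intros y Hy. exact Hy. }
      unfold disc in Hp. simpl in Hp. apply Rabs_def2 in Hp. assert (H := Hr p). lra. }
  exists l, M. split; [exact Hcl|]. split; [exact HM|]. intros N.
  apply Rnot_lt_le. intros Hlt.
  assert (HcN : continuous (enstrophy X N) l).
  { apply (total_continuous (fun n r => lambda n ^ 2 * X n r ^ 2)). intros n.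
    assert (H := flow_continuous _ _ _ _ (HX N) n). continuity. }
  destruct (positive_near (fun r => enstrophy X N r - M) l) as [d [Hd Hn]].
  { continuity. }
  { lra. }
  destruct (Hl (disc l (mkposreal d Hd)) N) as [p [HNp Hp]].
  { exists (mkposreal d Hd). intros y Hy. exact Hy. }
  specialize (Hn (r p) Hp).
  assert (enstrophy X N (r p) <= enstrophy X p (r p)).
  { apply total_mono; [exact HNp|]. intros n _. apply Rmult_le_pos; apply pow2_ge_0. }
  assert (Hrp := proj2 (Hr p)). lra.
Qed.

(** Numerical bounds on [2 ^ (j / k)] reduce to integer powers. *)
Lemma Rpower_le_of_pow (p b : R) (k j : nat) :
  0 < b -> (0 < k)%nat -> p * INR k = INR j -> 2 ^ j <= b ^ k -> Rpower 2 p <= b.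
Proof.
  intros Hb Hk Hp Hle. apply Rnot_lt_le. intros Hlt.
  assert (H := Rlt_Rpower_l b (Rpower 2 p) (INR k) (lt_0_INR k Hk) (conj Hb Hlt)).
  rewrite Rpower_mult, Hp, !Rpower_pow in H by lra. lra.
Qed.

Lemma Rpower_ge_of_pow (p b : R) (k j : nat) :
  0 < b -> (0 < k)%nat -> p * INR k = INR j -> b ^ k <= 2 ^ j -> b <= Rpower 2 p.
Proof.
  intros Hb Hk Hp Hle. apply Rnot_lt_le. intros Hlt.
  assert (H := Rlt_Rpower_l (Rpower 2 p) b (INR k) (lt_0_INR k Hk)
                 (conj (exp_pos _) Hlt)).
  rewrite Rpower_mult, Hp, !Rpower_pow in H by lra. lra.
Qed.

(** The exponent [a = (beta - 19/20) / 3] is chosen so that the ratio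
    [q = 2 ^ (3 a - beta)] of incoming to outgoing transfer is just above 1/2,
    whatever [beta].  It lies above the critical value [beta - 2] exactly when
    [beta < 101/40]. *)
Lemma region_constants (beta : R) :
  2 < beta ->
  1 / 2 <= Rpower 2 (- (19 / 20)) <= 13 / 25 /\
  3 <= Rpower 2 (beta - (beta - 19 / 20) / 3).
Proof.
  intros Hb. split.
  - rewrite Rpower_Ropp.
    assert (H1 : Rpower 2 (19 / 20) <= 2)
      by (apply (Rpower_le_of_pow _ _ 20 19); [lra|lia|simpl; lra|simpl; lra]).
    assert (H2 : 25 / 13 <= Rpower 2 (19 / 20))
      by (apply (Rpower_ge_of_pow _ _ 20 19); [lra|lia|simpl; lra|simpl; lra]).
    split.
    + replace (1 / 2) with (/ 2) by lra. apply Rinv_le_contravar; lra.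
    + replace (13 / 25) with (/ (25 / 13)) by lra. apply Rinv_le_contravar; lra.
  - apply Rle_trans with (Rpower 2 (8 / 5)).
    + apply (Rpower_ge_of_pow _ _ 5 8); [lra|lia|simpl; lra|simpl; lra].
    + apply Rle_Rpower; lra.
Qed.

Lemma geometric_small (r C : R) : 0 < r < 1 -> 0 < C ->
  exists N, forall n, (N < n)%nat -> r ^ n < C.
Proof.
  intros Hr HC.
  destruct (pow_lt_1_zero r ltac:(rewrite Rabs_right; lra) C HC) as [N HN].
  exists N. intros n Hn. specialize (HN n ltac:(lia)).
  rewrite Rabs_right in HN; [exact HN|]. apply Rle_ge, pow_le. lra.
Qed.

(** The variables [Y n = lambda n ^ a X n / M] satisfy the system of
    [normalized_region], with transfer rates [K n] of order [lambda n ^ (beta - a)].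
    As [a > beta - 2], these are eventually smaller than the viscous rates
    [nu lambda n ^ 2]. *)
Lemma supercritical_bound (nu beta s M : R) (X : nat -> R -> R) :
  let a := (beta - 19 / 20) / 3 in
  0 < nu -> 2 < beta <= 5 / 2 -> (forall N, flow nu beta N X) -> 0 <= s -> 0 < M ->
  (forall n, pw a n * X n s < 3 / 10 * M) ->
  forall n t, s <= t -> pw a n * X n t <= M.
Proof.
  intros a Hnu Hb HX Hs HM Hsm.
  set (q := Rpower 2 (- (19 / 20))). set (c := Rpower 2 (beta - a)).
  destruct (region_constants beta ltac:(lra)) as [Hq Hc].
  fold a in Hc. fold c in Hc. fold q in Hq.
  set (k := M * Rpower 2 (- a)).
  assert (Hk : 0 < k) by (apply Rmult_lt_0_compat; [exact HM|apply exp_pos]).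
  set (K := fun n => k * pw (beta - a) n).
  destruct (geometric_small (Rpower 2 (beta - a - 2)) (3 / 10 * nu / (q * k))) as [N HN].
  { split; [apply exp_pos|]. rewrite <- (Rpower_O 2) by lra.
    apply Rpower_lt; [lra|unfold a; lra]. }
  { apply Rdiv_lt_0_compat; [lra|apply Rmult_lt_0_compat; lra]. }
  set (Y := fun n t => pw a n * X n t / M).
  assert (HY : forall n t, s <= t -> Y n t <= 1).
  { apply (normalized_region nu q c s K N Y Hnu Hq Hc).
    - intros n. apply Rmult_lt_0_compat; [exact Hk|apply pw_pos].
    - intros n. unfold K, c. rewrite pw_S. ring.
    - intros n Hn. specialize (HN n Hn). rewrite <- pw_pow in HN.
      rewrite lambda_sq_pw by lia. unfold K.
      replace (pw (beta - a) n) with (pw (beta - a - 2) n * pw 2 n)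
        by (rewrite <- pw_plus; f_equal; ring).
      assert (Hqk : 0 < q * k) by (apply Rmult_lt_0_compat; lra).
      assert (H1 : pw (beta - a - 2) n * (q * k) < 3 / 10 * nu).
      { apply Rmult_lt_compat_r with (r := q * k) in HN; [|exact Hqk].
        replace (3 / 10 * nu / (q * k) * (q * k)) with (3 / 10 * nu) in HN by (field; lra).
        exact HN. }
      assert (H2 := pw_pos 2 n). nra.
    - intros n t. assert (H := flow_continuous _ _ _ _ (HX n) n). unfold Y, Rdiv. continuity.
    - intros n t. assert (H := flow_nonneg _ _ _ _ (HX n) n t). assert (Hp := pw_pos a n).
      apply Rdiv_le_0_compat; [apply Rmult_le_pos; lra|exact HM].
    - intros t. unfold Y. rewrite (flow_zero _ _ _ _ (HX O)). field. lra.
    - intros n t Ht.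
      assert (Hd := flow_derive _ _ _ _ (HX (S n)) (S n) t ltac:(lia) ltac:(lra)).
      rewrite field_S in Hd.
      unfold Y, Rdiv. eapply is_derive_eq; [derivative|]. cbv beta.
      assert (HpN := pw_pos a n). assert (H2a := exp_pos (a * ln 2)). fold (Rpower 2 a) in H2a.
      assert (Hc1 : pw a (S n) * coef beta (S n) * M
                    = K (S n) * (pw a (S n) * pw a (S (S n)))).
      { unfold K, k. rewrite coef_pw by lia. rewrite (pw_S a (S n)).
        replace (pw beta (S n)) with (pw (beta - a) (S n) * pw a (S n))
          by (rewrite <- pw_plus; f_equal; ring).
        replace (Rpower 2 (- a)) with (/ Rpower 2 a) by (rewrite Rpower_Ropp; reflexivity).
        field. lra. }
      assert (Hc2 : pw a (S n) * coef beta n * X n t ^ 2 * M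
                    = K (S n) * q * (pw a n * X n t) ^ 2).
      { destruct n as [|n]; [rewrite (flow_zero _ _ _ _ (HX O)); ring|].
        unfold K, k, q. rewrite coef_pw by lia. rewrite (pw_S a (S n)), (pw_S (beta - a) (S n)).
        assert (He : Rpower 2 (- a) * Rpower 2 (beta - a) * Rpower 2 (- (19 / 20)) = Rpower 2 a).
        { rewrite <- !Rpower_plus. f_equal. unfold a. field. }
        rewrite <- He.
        replace (pw beta (S n)) with (pw (beta - a) (S n) * pw a (S n))
          by (rewrite <- pw_plus; f_equal; ring).
        ring. }
      apply Rmult_eq_reg_r with (M * M); [|nra].
      match goal with |- ?L = ?R =>
        replace L with (- nu * lambda (S n) ^ 2 * pw a (S n) * X (S n) t * M
          + pw a (S n) * coef beta n * X n t ^ 2 * M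
          - pw a (S n) * coef beta (S n) * M * (X (S n) t * X (S (S n)) t)) by (field; lra);
        replace R with (- nu * lambda (S n) ^ 2 * pw a (S n) * X (S n) t * M
          + K (S n) * q * (pw a n * X n t) ^ 2
          - K (S n) * (pw a (S n) * pw a (S (S n))) * (X (S n) t * X (S (S n)) t)) by (field; lra)
      end.
      rewrite Hc1, Hc2. reflexivity.
    - intros n. unfold Y. apply Rlt_div_l; [exact HM|]. apply Hsm. }
  intros n t Ht. assert (H := HY n t Ht). unfold Y in H.
  apply Rle_div_l in H; [lra|exact HM].
Qed.

Definition bounded_after (X : nat -> R -> R) (g : R) : Prop :=
  forall s, 0 < s -> exists B, forall n t, (1 <= n)%nat -> s <= t -> pw g n * X n t <= B.

(** At a time of finite enstrophy [lambda n X n] is bounded, and [a <= 1]. *)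
Lemma supercritical_regularity (nu beta E : R) (X : nat -> R -> R) :
  0 < nu -> 2 < beta <= 5 / 2 -> (forall N, flow nu beta N X) ->
  (forall N, energy X N 0 <= E) -> bounded_after X ((beta - 19 / 20) / 3).
Proof.
  intros Hnu Hb HX HE s Hs.
  destruct (finite_enstrophy_time nu beta E 0 s X Hnu HX HE ltac:(lra))
    as [r [M [Hr [HM HrM]]]].
  exists (4 * (M + 1)). intros n t Hn Ht.
  apply (supercritical_bound nu beta r (4 * (M + 1)) X Hnu Hb HX ltac:(lra) ltac:(lra)); [|lra].
  clear n Hn. intros n. destruct n as [|n].
  - rewrite (flow_zero _ _ _ _ (HX O)). lra.
  - assert (H := term_le_total (fun n => lambda n ^ 2 * X n r ^ 2) (S n) (S n) ltac:(lia)
       (fun n _ => Rmult_le_pos _ _ (pow2_ge_0 (lambda n)) (pow2_ge_0 (X n r)))).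
    assert (H1 := HrM (S n)). unfold enstrophy in H1.
    assert (H2 : pw ((beta - 19 / 20) / 3) (S n) <= lambda (S n))
      by (rewrite lambda_pw by lia; apply pw_le; lra).
    assert (H3 := flow_nonneg _ _ _ _ (HX O) (S n) r).
    assert (H4 : lambda (S n) * X (S n) r <= M + 1) by (cbv beta in H; nra).
    assert (H5 : pw ((beta - 19 / 20) / 3) (S n) * X (S n) r <= lambda (S n) * X (S n) r)
      by (apply Rmult_le_compat_r; assumption).
    lra.
Qed.

(** The viscosity gains two powers of [lambda n] over the source term
    [lambda (n-1) ^ beta X (n-1) ^ 2], so that an exponent [g] improves to
    [2 g + 2 - beta], which is at least [g + e].  The factor [r - s0] in the barrier
    makes it vanish at the initial time, where nothing better than the exponent [g]
    is known. *)
Lemma regularity_gain (nu beta e g : R) (X : nat -> R -> R) :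
  0 < nu -> 0 < e <= 2 -> beta - 2 + e <= g -> (forall N, flow nu beta N X) ->
  bounded_after X g -> bounded_after X (g + e).
Proof.
  intros Hnu He Hg HX HB s Hs.
  destruct (HB (s / 2) ltac:(lra)) as [B HB2].
  assert (HB0 : 0 <= B).
  { eapply Rle_trans; [|apply (HB2 1%nat (s / 2)); [lia|lra]].
    apply Rmult_le_pos; [apply Rlt_le, pw_pos|apply (flow_nonneg _ _ _ _ (HX O))]. }
  set (C := Rpower 2 (g + e - 2)).
  assert (HC : 0 < C) by apply exp_pos.
  exists ((B + s / 2 * B ^ 2 * C) / (nu * (s / 2))). intros n t Hn Ht.
  assert (HXB : forall m r, (1 <= m)%nat -> s / 2 <= r -> X m r <= pw (- g) m * B).
  { intros m r Hm Hr. specialize (HB2 m r Hm Hr).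
    replace (X m r) with (pw (- g) m * (pw g m * X m r)).
    - apply Rmult_le_compat_l; [apply Rlt_le, pw_pos|exact HB2].
    - rewrite <- Rmult_assoc, <- pw_plus.
      replace (- g + g) with 0 by ring. unfold pw at 1.
      rewrite Rmult_0_l, Rpower_O by lra. ring. }
  set (P := coef beta (n - 1) * (pw (- g) (n - 1) * B) ^ 2).
  assert (HP0 : 0 <= P) by (apply Rmult_le_pos; [apply coef_nonneg|apply pow2_ge_0]).
  set (D := pw (- g) n * B + s / 2 * P).
  assert (HD0 : 0 <= D).
  { apply Rplus_le_le_0_compat; apply Rmult_le_pos; try lra. apply Rlt_le, pw_pos. }
  set (v := nu * lambda n ^ 2).
  assert (Hv : 0 < v) by (apply Rmult_lt_0_compat; [exact Hnu|apply lambda_sq_pos, Hn]).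
  set (s0 := t - s / 2).
  assert (HV : 0 <= D / v - (t - s0) * X n t).
  { apply (lower_barrier (fun r => D / v - (r - s0) * X n r)
      (fun r => 0 - ((1 - 0) * X n r + (r - s0) * field nu beta (fun m => X m r) n))
      (- v) s0 t).
    - unfold s0. lra.
    - intros r. assert (H := flow_continuous _ _ _ _ (HX O) n). continuity.
    - intros r Hr.
      assert (Hd := flow_derive _ _ _ _ (HX n) n r ltac:(lia) ltac:(unfold s0 in Hr; lra)).
      eapply is_derive_eq; [derivative|cbv beta; ring].
    - intros r Hr _. destruct n as [|n]; [lia|].
      rewrite field_S. replace (S n - 1)%nat with n in * by lia.
      assert (Hr1 : 0 < r - s0 <= s / 2) by (unfold s0 in *; lra).
      assert (HXr := HXB (S n) r Hn ltac:(unfold s0 in *; lra)).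
      assert (Hprev : coef beta n * X n r ^ 2 <= P).
      { unfold P. replace (S n - 1)%nat with n by lia.
        destruct n as [|n]; [rewrite coef_0; lra|].
        apply Rmult_le_compat_l; [apply coef_nonneg|].
        apply pow_incr. split; [apply (flow_nonneg _ _ _ _ (HX O))|].
        apply HXB; [lia|unfold s0 in *; lra]. }
      assert (Hflux : 0 <= coef beta (S n) * X (S n) r * X (S (S n)) r).
      { apply Rmult_le_pos; [apply Rmult_le_pos|]; try apply (flow_nonneg _ _ _ _ (HX O)).
        apply coef_nonneg. }
      assert (Hsrc : (r - s0) * (coef beta n * X n r ^ 2 - coef beta (S n) * X (S n) r * X (S (S n)) r)
                     <= s / 2 * P).
      { apply Rle_trans with ((r - s0) * P); [apply Rmult_le_compat_l; lra|].
        apply Rmult_le_compat_r; lra. }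
      replace (- v * (D / v - (r - s0) * X (S n) r))
        with (- D + v * ((r - s0) * X (S n) r)) by (field; lra).
      unfold D, v. lra.
    - replace (s0 - s0) with 0 by ring. rewrite Rmult_0_l, Rminus_0_r.
      apply Rdiv_le_0_compat; assumption. }
  replace (t - s0) with (s / 2) in HV by (unfold s0; ring).
  assert (HX1 : s / 2 * X n t <= D / v) by lra.
  assert (Hpe := pw_pos (g + e) n).
  assert (HDv : pw (g + e) n * D <= (B + s / 2 * B ^ 2 * C) * pw 2 n).
  { unfold D. rewrite Rmult_plus_distr_l, Rmult_plus_distr_r. apply Rplus_le_compat.
    - rewrite <- Rmult_assoc, <- pw_plus, (Rmult_comm B).
      apply Rmult_le_compat_r; [exact HB0|]. apply pw_le. lra.
    - unfold P. destruct n as [|[|n]]; [lia| |].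
      + simpl Nat.sub. rewrite coef_0.
        replace (pw (g + e) 1 * (s / 2 * (0 * (pw (- g) 0 * B) ^ 2))) with 0 by ring.
        apply Rmult_le_pos; [|apply Rlt_le, pw_pos].
        apply Rmult_le_pos; [|lra]. apply Rmult_le_pos; [lra|apply pow2_ge_0].
      + replace (S (S n) - 1)%nat with (S n) by lia. rewrite coef_pw by lia.
        replace (pw (g + e) (S (S n)) * (s / 2 * (pw beta (S n) * (pw (- g) (S n) * B) ^ 2)))
          with (s / 2 * B ^ 2 * (pw (g + e) (S (S n)) * (pw beta (S n) * (pw (- g) (S n) * pw (- g) (S n)))))
          by ring.
        rewrite (Rmult_assoc _ C).
        apply Rmult_le_compat_l; [apply Rmult_le_pos; [lra|apply pow2_ge_0]|].
        rewrite !pw_S with (n := S n). unfold C.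
        replace (Rpower 2 (g + e)) with (Rpower 2 (g + e - 2) * Rpower 2 2)
          by (rewrite <- Rpower_plus; f_equal; ring).
        replace (pw (g + e) (S n) * (Rpower 2 (g + e - 2) * Rpower 2 2)
                  * (pw beta (S n) * (pw (- g) (S n) * pw (- g) (S n))))
          with (Rpower 2 (g + e - 2) * Rpower 2 2
                  * (pw (g + e) (S n) * pw beta (S n) * pw (- g) (S n) * pw (- g) (S n))) by ring.
        rewrite <- !pw_plus.
        replace (Rpower 2 (g + e - 2) * (pw 2 (S n) * Rpower 2 2))
          with (Rpower 2 (g + e - 2) * Rpower 2 2 * pw 2 (S n)) by ring.
        apply Rmult_le_compat_l.
        * apply Rmult_le_pos; apply Rlt_le, exp_pos.
        * apply pw_le. lra. }
  assert (Hns : 0 < nu * (s / 2)) by (apply Rmult_lt_0_compat; lra).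
  apply (proj1 (Rle_div_r _ _ _ Hns)).
  apply (proj2 (Rle_div_r _ _ _ Hv)) in HX1.
  unfold v in HX1. rewrite lambda_sq_pw in HX1 by exact Hn.
  assert (Hp2 := pw_pos 2 n).
  apply Rmult_le_reg_r with (pw 2 n); [exact Hp2|].
  apply Rle_trans with (pw (g + e) n * D); [|exact HDv].
  replace (pw (g + e) n * X n t * (nu * (s / 2)) * pw 2 n)
    with (pw (g + e) n * (s / 2 * X n t * (nu * pw 2 n))) by ring.
  apply Rmult_le_compat_l; lra.
Qed.

Lemma full_regularity (nu beta E : R) (X : nat -> R -> R) (g : R) :
  0 < nu -> 2 < beta <= 5 / 2 -> (forall N, flow nu beta N X) ->
  (forall N, energy X N 0 <= E) -> bounded_after X g.
Proof.
  intros Hnu Hb HX HE.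
  set (a := (beta - 19 / 20) / 3). set (e := a - (beta - 2)).
  assert (He : 0 < e <= 2) by (unfold e, a; lra).
  assert (Hk : forall k, bounded_after X (a + INR k * e)).
  { induction k as [|k IH].
    - simpl. rewrite Rmult_0_l, Rplus_0_r.
      apply (supercritical_regularity nu beta E); assumption.
    - rewrite S_INR. replace (a + (INR k + 1) * e) with (a + INR k * e + e) by ring.
      apply (regularity_gain nu beta e _ X Hnu He); [|exact HX|exact IH].
      assert (H := Rmult_le_pos _ _ (pos_INR k) (Rlt_le _ _ (proj1 He))). unfold e at 1. lra. }
  destruct (INR_unbounded ((g - a) / e)) as [k Hgk].
  intros s Hs. destruct (Hk k s Hs) as [B HB]. exists B. intros n t Hn Ht.
  eapply Rle_trans; [|apply (HB n t Hn Ht)].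
  apply Rmult_le_compat_r; [apply (flow_nonneg _ _ _ _ (HX O))|].
  apply pw_le. apply Rlt_div_l in Hgk; [lra|apply He].
Qed.

Lemma bounded_smooth (X Y : nat -> R -> R) :
  (forall g, bounded_after X g) ->
  (forall n t, (1 <= n)%nat -> 0 <= t -> Y n t = X n t) -> smooth Y.
Proof.
  intros HX HY g t Hg Ht. destruct (HX g t Ht) as [B HB].
  apply (Rbar_le_lt_trans _ (Finite B)); [|exact I].
  apply (proj2 (Lub_Rbar_correct _)). intros y [n [Hn ->]].
  simpl. rewrite rpow_lambda by exact Hn. rewrite HY by (lia || lra).
  apply HB; [exact Hn|lra].
Qed.

Lemma total_le_series (a : nat -> R) (N : nat) :
  (forall n, 0 <= a n) -> ex_series (fun k => a (S k)) ->
  total a N <= Series (fun k => a (S k)).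
Proof.
  intros Ha Hex.
  assert (Hs : forall N, total a (S N) = sum_n (fun k => a (S k)) N).
  { induction N0 as [|M IH].
    - rewrite sum_O. simpl. ring.
    - rewrite sum_Sn, <- IH. reflexivity. }
  apply Rle_trans with (total a (S N)).
  - apply total_mono; [lia|intros n _; apply Ha].
  - rewrite Hs. apply (is_lim_seq_incr_compare (sum_n (fun k => a (S k)))).
    + apply (Series_correct _ Hex).
    + intros n. rewrite sum_Sn. unfold plus; simpl. assert (H := Ha (S (S n))). lra.
Qed.

Theorem theorem1 :
  forall (nu beta : R) (x : nat -> R),
    0 < nu ->
    2 < beta <= 5 / 2 ->
    (forall n : nat, (1 <= n)%nat -> 0 <= x n) ->
    ex_series (fun k : nat => (x (S k)) ^ 2) ->
    exists X : nat -> R -> R,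
      weak_solution nu beta x X /\
      (forall Y : nat -> R -> R, weak_solution nu beta x Y ->
         forall (n : nat) (t : R), (1 <= n)%nat -> 0 <= t -> Y n t = X n t) /\
      smooth X.
Proof.
  intros nu beta x Hnu Hb Hx Hsum.
  set (E := Series (fun k => x (S k) ^ 2)).
  assert (HE : forall N, total (fun n => x n ^ 2) N <= E).
  { intros N. apply (total_le_series (fun n => x n ^ 2));
      [intros n; apply pow2_ge_0|exact Hsum]. }
  assert (HE0 : 0 <= E) by exact (HE O).
  destruct (existence nu beta (E + 1) x Hnu ltac:(lra) ltac:(lra) Hx
              ltac:(intros N; assert (H := HE N); nra)) as [X HX].
  assert (Hinit : forall Y, weak_solution nu beta x Y ->
            forall n, (1 <= n)%nat -> half_line Y n 0 = x n).
  { intros Y HY n Hn. rewrite half_line_eq by (lia || lra). apply (HY n Hn). }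
  assert (HEX : forall Y, weak_solution nu beta x Y ->
            forall N, energy (half_line Y) N 0 <= E).
  { intros Y HY N. apply Rle_trans with (total (fun n => x n ^ 2) N); [|apply HE].
    apply total_le. intros n Hn. rewrite (Hinit Y HY) by lia. lra. }
  assert (Hflow : forall Y, weak_solution nu beta x Y ->
            forall N, flow nu beta N (half_line Y)).
  { intros Y HY N. apply (weak_solution_flow nu beta x); assumption. }
  exists X. split; [exact HX|]. split.
  - intros Y HY n t Hn Ht.
    rewrite <- (half_line_eq X n t Hn Ht), <- (half_line_eq Y n t Hn Ht).
    apply (flow_unique nu beta E); auto; try lra.
    intros m Hm. rewrite !Hinit by assumption. reflexivity.
  - apply (bounded_smooth (half_line X)).
    + intros g. apply (full_regularity nu beta E); auto.
    + intros n t Hn Ht. symmetry. apply half_line_eq; assumption.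
Qed.
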